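(* Let $\mathcal{A}$ be a commutative unital $C^*$-subalgebra of $\mathbb{M}_d$. Then there exists $\varepsilon>0$ such that every unital quantum channel $\tau$ on $\mathbb{M}_d$ satisfying $\mathcal{A}\subseteq\mathrm{Fix}(\tau)\cap\mathrm{Range}(\tau)'$ and $\|\mathbb{E}_{\mathcal{A}}-\tau\|<\varepsilon$ is a mixed twisted dephasing channel.
   Context: $\mathbb{M}_d$ is the algebra of $d\times d$ complex matrices and $\mathbb{U}(d)$ its unitary group. Unital subalgebra means containing $I_d$. For $S\subseteq\mathbb{M}_d$, $S'$ denotes the commutant in $\mathbb{M}_d$. A quantum channel on $\mathbb{M}_d$ is a completely positive, trace-preserving linear map; $\mathrm{Fix}(\tau)=\{X:\tau(X)=X\}$. $\mathbb{E}_{\mathcal{A}}$ is the trace-preserving conditional expectation of $\mathbb{M}_d$ onto $\mathcal{A}$, i.e. the orthogonal projection onto $\mathcal{A}$ with respect to $\langle X,Y\rangle=\mathrm{Tr}(X^*Y)$. $\|\cdot\|$ is a fixed norm on the finite-dimensional space of linear maps on $\mathbb{M}_d$ (all such norms being equivalent, the choice is immaterial). $\mathrm{Ad}_U(X)=UXU^*$; $\Delta_d(X)=\sum_{j=1}^d\langle e_j,Xe_j\rangle|e_j\rangle\langle e_j|$ with $\{e_j\}$ the standard basis of $\mathbb{C}^d$; for $U,V\in\mathbb{U}(d)$, $\beta_{U,V}=\mathrm{Ad}_U\circ\Delta_d\circ\mathrm{Ad}_{V^*}$. A mixed twisted dephasing channel is a finite convex combination of maps $\beta_{U,V}$, $U,V\in\mathbb{U}(d)$.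 *)

(* Defs.v *)
From HB Require Import structures.
From mathcomp Require Import all_boot all_order all_algebra.
From mathcomp Require Import classical_sets reals complex.

Set Implicit Arguments.
Unset Strict Implicit.
Unset Printing Implicit Defensive.

Import Order.TTheory GRing.Theory Num.Theory.
Local Open Scope ring_scope.
Local Open Scope complex_scope.
Local Open Scope sesquilinear_scope.
Local Open Scope classical_set_scope.

Section Definitions.
Variables (R : realType) (d : nat).
Local Notation C := R[i].
Local Notation M := 'M[C]_d.

(* A linear subspace of M_d which is a unital C*-subalgebra: closedness in norm
   is automatic in finite dimension. *)
Record unital_cstar_subalgebra (A : {vspace M}) : Prop := {
  cstar_unit : 1%:M \in A;
  cstar_mul : forall X Y, X \in A -> Y \in A -> X *m Y \in A;
  cstar_star : forall X, X \in A -> X^t* \in A }.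

Definition commutative_subspace (A : {vspace M}) : Prop :=
  forall X Y, X \in A -> Y \in A -> X *m Y = Y *m X.

Definition commutant (S : set M) : set M :=
  [set X | forall Y, S Y -> X *m Y = Y *m X].

Definition psdmx n (P : 'M[C]_n) : Prop :=
  forall v : 'cV[C]_n, 0 <= (v^t* *m P *m v) 0 0.

(* M_k (x) M_d is identified with k x k block matrices with blocks in M_d, so
   id_k (x) tau acts blockwise. *)
Definition completely_positive (tau : 'End(M)) : Prop :=
  forall k (B : 'I_k -> 'I_k -> M),
    psdmx (\mxblock_(i < k, j < k) B i j) ->
    psdmx (\mxblock_(i < k, j < k) tau (B i j)).

Definition trace_preserving (tau : 'End(M)) : Prop :=
  forall X, \tr (tau X) = \tr X.

Definition quantum_channel (tau : 'End(M)) : Prop :=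
  completely_positive tau /\ trace_preserving tau.

Definition unital_map (tau : 'End(M)) : Prop := tau 1%:M = 1%:M.

Definition hs_ip (X Y : M) : C := \tr (X^t* *m Y).

Definition hs_coord (A : {vspace M}) (X : M) : 'rV[C]_(\dim A) :=
  \row_i hs_ip (vbasis A)`_i X.

Fact hs_coord_linear A : linear (hs_coord A).
Proof.
by move=> a X Y; apply/rowP=> i; rewrite !mxE /hs_ip mulmxDr -scalemxAr !linearE.
Qed.

HB.instance Definition _ A :=
  GRing.isLinear.Build C M 'rV[C]_(\dim A) _ (hs_coord A) (hs_coord_linear A).

Definition hs_orth (A : {vspace M}) : {vspace M} := lker (linfun (hs_coord A)).

(* See hs_orthP, cond_exp_mem and cond_exp_orth below: this is the orthogonal
   projection onto A for hs_ip. *)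
Definition cond_exp (A : {vspace M}) : 'End(M) := daddv_pi A (hs_orth A).

Definition ad_map (U X : M) : M := U *m X *m U^t*.

Fact ad_map_linear U : linear (ad_map U).
Proof.
by move=> a X Y; rewrite /ad_map mulmxDr mulmxDl -scalemxAr -scalemxAl.
Qed.

HB.instance Definition _ U :=
  GRing.isLinear.Build C M M _ (ad_map U) (ad_map_linear U).

Definition Ad (U : M) : 'End(M) := linfun (ad_map U).

Definition dephase (X : M) : M := \sum_(j < d) X j j *: delta_mx j j.

Fact dephase_linear : linear dephase.
Proof.
move=> a X Y; rewrite /dephase scaler_sumr -big_split /=.
by apply: eq_bigr => j _; rewrite !mxE scalerDl scalerA.
Qed.

HB.instance Definition _ :=
  GRing.isLinear.Build C M M _ dephase dephase_linear.

Definition Delta : 'End(M) := linfun dephase.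

Definition twisted_dephasing (U V : M) : 'End(M) :=
  (Ad U \o Delta \o Ad (V^t*))%VF.

Definition mixed_twisted_dephasing (tau : 'End(M)) : Prop :=
  exists (n : nat) (p : 'I_n -> R) (U V : 'I_n -> M),
    [/\ forall i, 0 <= p i,
        \sum_(i < n) p i = 1,
        forall i, U i \is unitarymx /\ V i \is unitarymx &
        tau = \sum_(i < n) (p i)%:C *: twisted_dephasing (U i) (V i)].

End Definitions.

(* The values of N are real, so homogeneity is stated in R[i], where `|c| lives;
   nonnegativity of N follows from the triangle inequality. *)
Record is_norm (R : realType) (E : lmodType R[i]) (N : E -> R) : Prop := {
  norm_definite : forall f, N f = 0 -> f = 0;
  norm_homogeneous : forall (c : R[i]) f, (N (c *: f))%:C = `|c| * (N f)%:C;
  norm_triangle : forall f g, N (f + g) <= N f + N g }.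

Section Checks.
Variables (R : realType) (d : nat).
Local Notation C := R[i].
Local Notation M := 'M[C]_d.

Lemma hs_orthP (A : {vspace M}) (X : M) :
  reflect (forall Y, Y \in A -> hs_ip Y X = 0) (X \in hs_orth A).
Proof.
rewrite memv_ker lfunE /=; apply: (iffP eqP) => [/rowP h Y /coord_vbasis -> | h].
  rewrite /hs_ip linear_sum rmorph_sum /= mulmx_suml linear_sum big1 // => i _.
  rewrite linearZ /= map_mxZ -scalemxAl linearZ /=.
  by have := h i; rewrite !mxE /hs_ip => ->; rewrite mulr0.
by apply/rowP=> i; rewrite !mxE h // vbasis_mem // mem_nth // size_tuple.
Qed.

Lemma hs_ip_eq0 (X : M) : hs_ip X X = 0 -> X = 0.
Proof.
rewrite /hs_ip /mxtrace => h; apply/matrixP=> i j; rewrite mxE.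
have h0 (a b : 'I_d) : 0 <= X^t* a b * X b a by rewrite !mxE mulrC mul_conjC_ge0.
have /(_ j isT) : forall a, true -> (X^t* *m X) a a = 0.
  apply/psumr_eq0P => // a _; rewrite mxE; exact: sumr_ge0.
rewrite mxE => /psumr_eq0P => /(_ (fun a _ => h0 j a) i isT).
by rewrite !mxE mulrC => /eqP; rewrite mul_conjC_eq0 => /eqP.
Qed.

Lemma hs_orth_cap (A : {vspace M}) : (A :&: hs_orth A = 0)%VS.
Proof.
apply/eqP; rewrite -subv0; apply/subvP=> X; rewrite memv_cap memv0.
by case/andP=> XA /hs_orthP /(_ X XA) /hs_ip_eq0 ->.
Qed.

Lemma hs_orth_add (A : {vspace M}) : (A + hs_orth A = fullv)%VS.
Proof.
apply/eqP; rewrite eqEdim subvf /= dimv_disjoint_sum ?hs_orth_cap //.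
rewrite -(limg_ker_dim (linfun (hs_coord A)) fullv) capfv addnC leq_add2r.
by rewrite (leq_trans (dimvS (subvf _))) // dimvf /dim /= mul1n.
Qed.

Lemma cond_exp_mem (A : {vspace M}) (X : M) : cond_exp A X \in A.
Proof. exact: memv_pi. Qed.

Lemma cond_exp_orth (A : {vspace M}) (X Y : M) :
  Y \in A -> hs_ip Y (X - cond_exp A X) = 0.
Proof.
move=> YA; suff /hs_orthP : X - cond_exp A X \in hs_orth A by apply.
have := daddv_pi_add (hs_orth_cap A) (_ : X \in A + hs_orth A)%VS.
rewrite hs_orth_add memvf => /(_ isT) {1}<-.
by rewrite addrAC subrr add0r memv_pi.
Qed.

Lemma twisted_dephasingE (U V X : M) :
  twisted_dephasing U V X =
  U *m (\sum_(j < d) (V^t* *m X *m V) j j *: delta_mx j j) *m U^t*.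
Proof. by rewrite !comp_lfunE !lfunE /= /ad_map /dephase trmxCK. Qed.

End Checks.

(* Main.v *)
(** A unitary diagonalizes A; it partitions the standard basis into classes and turns E_A
    into the block mean Phi, which replaces each diagonal entry by the mean over its class
    and kills the off-diagonal entries.  As Phi is the mean of Ad_s o Delta over the
    permutations s that preserve the classes, Phi can be moved a little in the directions
    Ad_g o (Delta - Phi) o Ad_h, with g and h block unitary, inside the convex set of mixed
    twisted dephasing maps.  For a transposition s, Delta - Ad_s o Delta is the rank one map
    X |-> tr(Z X) Z with Z a difference of two diagonal units, so conjugation yields all
    X |-> tr(K X) H with H and K Hermitian, traceless and supported in one common class.
    On the other hand, positivity of the Choi matrix, A in Fix(tau) and the range condition
    force tau - Phi to be a real combination of such maps, whose coefficients are small
    when tau is close to Phi. *)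

Require Import Defs.
From HB Require Import structures.
From mathcomp Require Import all_boot all_order all_algebra.
From mathcomp Require Import all_fingroup.
From mathcomp Require Import ring lra.
From mathcomp Require Import boolp classical_sets reals complex.
From mathcomp Require functions topology normedtype derive.

Set Implicit Arguments.
Unset Strict Implicit.
Unset Printing Implicit Defensive.

Import Order.TTheory GRing.Theory Num.Theory.
Local Open Scope ring_scope.
Local Open Scope complex_scope.
Local Open Scope sesquilinear_scope.
Local Open Scope classical_set_scope.

(** * Mixed twisted dephasing maps: convexity and conjugation *)

Section Mixtures.
Variables (R : realType) (d : nat).
Local Notation C := R[i].
Local Notation M := 'M[C]_d.

Lemma AdE (U X : M) : Ad U X = U *m X *m U^t*.
Proof. by rewrite lfunE. Qed.

Lemma DeltaE (X : M) : Delta R d X = \sum_(j < d) X j j *: delta_mx j j.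
Proof. by rewrite lfunE. Qed.

Lemma Ad_comp (U V : M) : (Ad U \o Ad V)%VF = Ad (U *m V).
Proof.
by apply/lfunP => X; rewrite comp_lfunE !AdE trmx_mul map_mxM !mulmxA.
Qed.

Lemma Ad1 : Ad 1%:M = \1%VF :> 'End(M).
Proof. by apply/lfunP => X; rewrite AdE lfunE /= trmx1 map_mx1 mulmx1 mul1mx. Qed.

Lemma adjmx_unitary (U : M) : U \is unitarymx -> U^t* \is unitarymx.
Proof. by rewrite trmxC_unitary. Qed.

Lemma unitarymx1 : (1%:M : M) \is unitarymx.
Proof. by apply/unitarymxP; rewrite trmx1 map_mx1 mulmx1. Qed.

Lemma unitary_mulmxtV (U : M) : U \is unitarymx -> U *m U^t* = 1%:M.
Proof. by move/unitarymxP. Qed.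

Lemma unitary_multVmx (U : M) : U \is unitarymx -> U^t* *m U = 1%:M.
Proof. by move=> hU; apply: mulmx1C; exact: unitary_mulmxtV. Qed.

Lemma mixed_fin (I : finType) (p : I -> R) (U V : I -> M) :
  (forall i, 0 <= p i) -> \sum_i p i = 1 ->
  (forall i, U i \is unitarymx /\ V i \is unitarymx) ->
  mixed_twisted_dephasing (\sum_i (p i)%:C *: twisted_dephasing (U i) (V i)).
Proof.
move=> p0 p1 UV; exists #|I|, (p \o enum_val), (U \o enum_val), (V \o enum_val).
split => [i|||] //=; first by rewrite -p1 [RHS](reindex _ (onW_bij _ (enum_val_bij I))).
by rewrite [LHS](reindex _ (onW_bij _ (enum_val_bij I))).
Qed.

Lemma mixed_convex (I : finType) (q : I -> R) (tau : I -> 'End(M)) :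
  (forall i, 0 <= q i) -> \sum_i q i = 1 ->
  (forall i, mixed_twisted_dephasing (tau i)) ->
  mixed_twisted_dephasing (\sum_i (q i)%:C *: tau i).
Proof.
move=> q0 q1; rewrite {1}/mixed_twisted_dephasing => /choice[n mix0].
(* The types of the remaining witnesses depend on [n i], so they are extracted index by index and
   the double sum is flattened over a sigma type. *)
pose p i := projT1 (cid (mix0 i)); have mix1 i := projT2 (cid (mix0 i)).
pose U i := projT1 (cid (mix1 i)); have mix2 i := projT2 (cid (mix1 i)).
pose V i := projT1 (cid (mix2 i)).
have mix i : [/\ forall j, 0 <= p i j, \sum_j p i j = 1,
    forall j, U i j \is unitarymx /\ V i j \is unitarymx &
    tau i = \sum_j (p i j)%:C *: twisted_dephasing (U i j) (V i j)].
  exact: projT2 (cid (mix2 i)).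
pose J := {i : I & 'I_(n i)}.
rewrite (_ : \sum_i _ = \sum_(x : J) (q (tag x) * p (tag x) (tagged x))%:C *:
    twisted_dephasing (U (tag x) (tagged x)) (V (tag x) (tagged x))).
  apply: mixed_fin => [[i j]||[i j]] /=.
  - by case: (mix i) => p0 _ _ _; rewrite mulr_ge0.
  - rewrite -[LHS](@sig_big_dep R 0 +%R I (fun i => 'I_(n i)) xpredT (fun _ _ => true)
      (fun i j => q i * p i j)) /= -q1.
    apply: eq_bigr => i _; rewrite -mulr_sumr.
    by case: (mix i) => _ -> _ _; rewrite mulr1.
  - by case: (mix i).
rewrite -[RHS](@sig_big_dep _ 0 +%R I (fun i => 'I_(n i)) xpredT (fun _ _ => true)
  (fun i j => (q i * p i j)%:C *: twisted_dephasing (U i j) (V i j))) /=.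
apply: eq_bigr => i _; case: (mix i) => _ _ _ ->.
by rewrite scaler_sumr; apply: eq_bigr => j _; rewrite scalerA rmorphM.
Qed.

(** The unitaries are absorbed into the twists: [Ad g] and [Ad h] turn the pair (U, V) into (g U,
    h^* V). *)
Lemma mixed_Ad (g h : M) (tau : 'End(M)) :
  g \is unitarymx -> h \is unitarymx -> mixed_twisted_dephasing tau ->
  mixed_twisted_dephasing (Ad g \o tau \o Ad h)%VF.
Proof.
move=> hg hh [n [p [U [V [p0 p1 UV ->]]]]].
rewrite (_ : (_ \o _ \o _)%VF =
    \sum_(i < n) (p i)%:C *: twisted_dephasing (g *m U i) (h^t* *m V i)).
  apply: (mixed_fin p0 p1) => i; have [hU hV] := UV i.
  by split; [exact: mul_unitarymx hg hU|exact: mul_unitarymx (adjmx_unitary hh) hV].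
apply/lfunP => X; rewrite !comp_lfunE !sum_lfunE linear_sum /=.
apply: eq_bigr => i _; rewrite !scale_lfunE linearZ /= /twisted_dephasing.
by rewrite trmx_mul map_mxM trmxCK -!Ad_comp !comp_lfunE.
Qed.

Lemma mixed_Delta : mixed_twisted_dephasing (Delta R d).
Proof.
exists 1, (fun=> 1), (fun=> 1%:M), (fun=> 1%:M); split => //.
- by rewrite big_ord1.
- by move=> _; rewrite !unitarymx1.
rewrite big_ord1 scale1r /twisted_dephasing trmx1 map_mx1 Ad1.
by rewrite comp_lfun1l comp_lfun1r.
Qed.

End Mixtures.

(** * Block means, block unitaries and admissible directions *)

Section Blocks.
Variables (R : realType) (d : nat) (T : eqType) (kappa : 'I_d -> T).
Local Notation C := R[i].
Local Notation M := 'M[C]_d.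

Definition class_mx (f : T -> C) : M := diag_mx (\row_i f (kappa i)).

Definition class_proj (c : T) : M := class_mx (fun c' => (c' == c)%:R).

(** [class_mx] evaluates its function only at values of [kappa], whose classes are nonempty, so no
    relevant denominator is zero. *)
Definition block_mean (X : M) : M :=
  class_mx (fun c => \tr (class_proj c *m X) / \tr (class_proj c)).

Fact block_mean_linear : linear block_mean.
Proof.
move=> a X Y; rewrite /block_mean /class_mx -linearZ -linearD /=; congr diag_mx.
by apply/rowP => i; rewrite !mxE mulmxDr -scalemxAr mxtraceD mxtraceZ mulrDl mulrA.
Qed.

HB.instance Definition _ :=
  GRing.isLinear.Build C M M _ block_mean block_mean_linear.

Definition Block_mean : 'End(M) := linfun block_mean.

Definition block_unitary (g : M) : Prop :=
  g \is unitarymx /\ forall i j, kappa i != kappa j -> g i j = 0.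

Lemma class_mxE f k l : class_mx f k l = f (kappa k) *+ (k == l).
Proof. by rewrite !mxE. Qed.

Lemma tr_class_projM c (X : M) :
  \tr (class_proj c *m X) = \sum_(j | kappa j == c) X j j.
Proof.
rewrite /mxtrace [RHS]big_mkcond; apply: eq_bigr => j _.
by rewrite mul_diag_mx !mxE; case: eqP => _; rewrite ?mul1r ?mul0r.
Qed.

Lemma tr_class_proj c : \tr (class_proj c) = #|[pred j | kappa j == c]|%:R.
Proof.
rewrite -[class_proj c]mulmx1 tr_class_projM (eq_bigr (fun=> 1)) => [|j _].
  by rewrite sumr_const.
by rewrite mxE eqxx.
Qed.

Lemma class_card_neq0 k : #|[pred j | kappa j == kappa k]|%:R != 0 :> C.
Proof. by rewrite pnatr_eq0 -lt0n; apply/card_gt0P; exists k; rewrite inE. Qed.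

Lemma Block_meanE (X : M) k l : Block_mean X k l =
  ((\sum_(j | kappa j == kappa k) X j j) /
     #|[pred j | kappa j == kappa k]|%:R) *+ (k == l).
Proof. by rewrite lfunE /= class_mxE tr_class_projM tr_class_proj. Qed.

(** As [T] need not be finite, the sum runs over indices instead of classes; each class is then
    counted as often as it has elements, hence the division. *)
Lemma class_mx_sum (f : T -> C) : class_mx f =
  \sum_i (f (kappa i) / #|[pred j | kappa j == kappa i]|%:R) *: class_proj (kappa i).
Proof.
apply/matrixP => k l; rewrite class_mxE summxE.
under eq_bigr do rewrite mxE class_mxE.
have [_|_] := eqVneq k l; last by rewrite big1 // => i _; rewrite mulr0.
rewrite (bigID (fun i => kappa i == kappa k)) /= [X in _ = _ + X]big1 ?addr0; last first.
  by move=> i ik; rewrite eq_sym (negPf ik) mulr0.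
rewrite (eq_bigr (fun=> f (kappa k) / #|[pred j | kappa j == kappa k]|%:R)).
  by rewrite sumr_const -[RHS]mulr_natr divfK // class_card_neq0.
by move=> i /eqP ->; rewrite eqxx mulr1.
Qed.

Lemma class_mx_comm f (g : M) : (forall i j, kappa i != kappa j -> g i j = 0) ->
  class_mx f *m g = g *m class_mx f.
Proof.
move=> hg; apply/matrixP => i j; rewrite mul_diag_mx mul_mx_diag !mxE.
by have [->|/hg ->] := eqVneq (kappa i) (kappa j); [rewrite mulrC|rewrite mul0r mulr0].
Qed.

(** A block unitary commutes with every [class_mx]. It therefore cancels in the traces against class
    projections, and it fixes the values of the block mean. *)
Lemma Block_mean_Ad g : block_unitary g ->
  (Block_mean \o Ad g)%VF = Block_mean /\ (Ad g \o Block_mean)%VF = Block_mean.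
Proof.
move=> [gU gb]; split; apply/lfunP => X; rewrite comp_lfunE.
  rewrite [LHS]lfunE [RHS]lfunE /= /block_mean.
  congr class_mx; apply: funext => c; congr (_ / _).
  rewrite AdE !mulmxA class_mx_comm // mxtrace_mulC !mulmxA.
  by rewrite unitary_multVmx // mul1mx.
by rewrite [Block_mean X]lfunE AdE /= -class_mx_comm // -mulmxA unitary_mulmxtV // mulmx1.
Qed.

Lemma block_unitaryM g h : block_unitary g -> block_unitary h ->
  block_unitary (g *m h).
Proof.
move=> [gU gb] [hU hb]; split; first exact: mul_unitarymx gU hU.
move=> i j ij; rewrite mxE big1 // => k _.
have [ik|/gb ->] := eqVneq (kappa i) (kappa k); last by rewrite mul0r.
by rewrite hb ?mulr0 // -ik.
Qed.

Lemma block_unitary_adj g : block_unitary g -> block_unitary (g^t*).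
Proof.
move=> [gU gb]; split; first exact: adjmx_unitary.
by move=> i j ij; rewrite !mxE gb ?conjC0 // eq_sym.
Qed.

Lemma block_unitary1 : block_unitary 1%:M.
Proof.
split=> [|i j]; first exact: unitarymx1.
by rewrite mxE; case: (eqVneq i j) => [->|//]; rewrite eqxx.
Qed.

Lemma perm_mx_adj (s : 'S_d) : (perm_mx s : M)^t* = perm_mx s^-1.
Proof. by rewrite tr_perm_mx map_perm_mx. Qed.

Lemma perm_mx_conjE (s : 'S_d) (X : M) k l :
  (perm_mx s *m X *m (perm_mx s)^t*) k l = X (s k) (s l).
Proof. by rewrite perm_mx_adj -row_permE -col_permE !mxE. Qed.

Lemma perm_mx_unitary (s : 'S_d) : (perm_mx s : M) \is unitarymx.
Proof. by apply/unitarymxP; rewrite perm_mx_adj -perm_mxM mulgV perm_mx1. Qed.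

Definition class_perms := [set s : 'S_d | [forall i, kappa (s i) == kappa i]]%SET.

Lemma class_permsP (s : 'S_d) : reflect (forall i, kappa (s i) = kappa i) (s \in class_perms).
Proof. by rewrite inE; apply: (iffP forallP) => h i; apply/eqP; rewrite h. Qed.

Lemma perm_block_unitary (s : 'S_d) : s \in class_perms -> block_unitary (perm_mx s).
Proof.
move=> /class_permsP sk; split; first exact: perm_mx_unitary.
move=> i j; rewrite !mxE; case: (eqVneq (s i) j) => // <-.
by rewrite sk eqxx.
Qed.

Lemma tperm_class i j : kappa i = kappa j -> tperm i j \in class_perms.
Proof. by move=> ij; apply/class_permsP => k; case: tpermP => [->|->|]. Qed.

Lemma class_permsM (s t : 'S_d) : s \in class_perms -> t \in class_perms ->
  (s * t)%g \in class_perms.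
Proof.
by move=> /class_permsP hs /class_permsP ht; apply/class_permsP => i; rewrite permM ht hs.
Qed.

Lemma Delta_entry (X : M) k l : Delta R d X k l = X k k *+ (k == l).
Proof.
rewrite DeltaE summxE (bigD1 k) //= big1 ?addr0 => [|j jk]; last first.
  by rewrite !mxE (eq_sym k) (negPf jk) mulr0.
by rewrite !mxE eqxx /= (eq_sym l) mulr_natr.
Qed.

Lemma class_perms_gt0 : (0 < #|class_perms|)%N.
Proof. by apply/card_gt0P; exists 1%g; apply/class_permsP => i; rewrite perm1. Qed.

(* The diagonal entries of the mean are constant on each class, because a
   transposition permutes the group, and their sum over a class is that of X. *)
Lemma Block_mean_perms : Block_mean =
  \sum_(s in class_perms) (#|class_perms|%:R^-1)%:C *: (Ad (perm_mx s) \o Delta R d)%VF.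
Proof.
pose m : R := #|class_perms|%:R.
have m0 : m != 0 by rewrite pnatr_eq0 -lt0n class_perms_gt0.
apply/lfunP => X; apply/matrixP => k l.
pose f k := \sum_(s in class_perms) X (s k) (s k).
have -> : (\sum_(s in class_perms) (m^-1)%:C *: (Ad (perm_mx s) \o Delta R d)%VF) X k l =
    ((m^-1)%:C * f k) *+ (k == l).
  rewrite sum_lfunE summxE mulr_sumr -sumrMnl; apply: eq_bigr => s _.
  rewrite scale_lfunE mxE comp_lfunE AdE perm_mx_conjE Delta_entry (inj_eq perm_inj).
  by case: eqP => _; rewrite ?mulr1n // !mulr0n mulr0.
rewrite Block_meanE; congr (_ *+ _).
have fc j : kappa j = kappa k -> f j = f k.
  move=> jk; rewrite /f (reindex_inj (mulgI (tperm j k))) /=.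
  apply: eq_big => [s|s _]; last by rewrite permM tpermL.
  apply/idP/idP => [h|]; last by apply: class_permsM; apply: tperm_class.
  by rewrite -(mulKg (tperm j k) s) tpermV class_permsM ?tperm_class.
have : \sum_(j | kappa j == kappa k) f j = m%:C * \sum_(j | kappa j == kappa k) X j j.
  rewrite exchange_big /= (eq_bigr (fun=> \sum_(j | kappa j == kappa k) X j j)).
    by rewrite sumr_const -mulr_natl /m rmorph_nat.
  move=> s /class_permsP sk; rewrite [RHS](reindex_inj (@perm_inj _ s)) /=.
  by apply: eq_bigl => j; rewrite sk.
rewrite (eq_bigr (fun=> f k)) => [|j /eqP]; last exact: fc.
rewrite sumr_const => h; apply: (mulfI (class_card_neq0 k)).
rewrite mulrCA divff ?class_card_neq0 // mulr1 mulrCA [X in _ * X]mulr_natl h.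
by rewrite mulrA -rmorphM mulVf // mul1r.
Qed.

Lemma mixed_Block_mean : mixed_twisted_dephasing Block_mean.
Proof.
have m0 : (#|class_perms|%:R : R) != 0 by rewrite pnatr_eq0 -lt0n class_perms_gt0.
rewrite Block_mean_perms big_mkcond /=.
rewrite (eq_bigr (fun s => (if s \in class_perms then #|class_perms|%:R^-1 else 0 : R)%:C *:
  (Ad (perm_mx s) \o Delta R d \o Ad 1%:M)%VF)) => [|s _]; last first.
  by rewrite Ad1 comp_lfun1r; case: ifP; rewrite ?scale0r.
apply: mixed_convex => [s||s].
- by case: ifP => //; rewrite invr_ge0 ler0n.
- by rewrite -big_mkcond sumr_const -[LHS]mulr_natr mulVf.
- by apply: mixed_Ad; [exact: perm_mx_unitary|exact: unitarymx1|exact: mixed_Delta].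
Qed.

(** Both signs of [x] are required, so that the admissible directions form a real vector space. *)
Definition admissible (G : 'End(M)) : Prop :=
  exists2 t : R, 0 < t &
    forall x : R, `|x| <= t -> mixed_twisted_dephasing (Block_mean + x%:C *: G).

(** The perturbed map is the average over i of the mixtures [Block_mean + (#|I| * x i) G i]. This
    yields one radius that works for all coefficients simultaneously. *)
Lemma admissible_family (I : finType) (G : I -> 'End(M)) :
  (forall i, admissible (G i)) ->
  exists2 t : R, 0 < t & forall x : I -> R, (forall i, `|x i| <= t) ->
    mixed_twisted_dephasing (Block_mean + \sum_i (x i)%:C *: G i).
Proof.
move=> adm.
have /choice[t ht] i : exists t : R, 0 < t /\
    forall x : R, `|x| <= t -> mixed_twisted_dephasing (Block_mean + x%:C *: G i).
  by have [t t0 h] := adm i; exists t.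
have [I0|I0] := posnP #|I|.
  exists 1 => // x _; rewrite big1 ?addr0 => [|i _]; first exact: mixed_Block_mean.
  by have := fintype0 i I0.
have n0 : 0 < #|I|%:R :> R by rewrite ltr0n.
(* The 1 is only the starting value of the minimum of the radii. *)
pose u := \big[Order.min/1]_i t i.
exists (u / #|I|%:R) => [|x hx].
  rewrite divr_gt0 // /u; elim/big_ind: _ => // [a b a0 b0|i _]; last by case: (ht i).
  by rewrite lt_min a0.
rewrite (_ : _ + _ = \sum_i (#|I|%:R^-1)%:C *: (Block_mean + (#|I|%:R * x i)%:C *: G i)).
  apply: mixed_convex => [_||i].
  - by rewrite invr_ge0 ltW.
  - by rewrite sumr_const -[LHS]mulr_natr mulVf ?gt_eqF.
  - apply: (ht i).2; rewrite normrM (ger0_norm (ltW n0)) mulrC -ler_pdivlMr //.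
    rewrite (le_trans (hx i)) // ler_pM2r ?invr_gt0 //.
    exact: bigmin_le_cond.
under [RHS]eq_bigr do rewrite scalerDr scalerA -rmorphM /= mulKf ?gt_eqF //.
rewrite big_split /= sumr_const -scaler_nat scalerA -(rmorph_nat (real_complex R)).
by rewrite -rmorphM divff ?gt_eqF // scale1r.
Qed.

Lemma admissible_comb (a b : R) G H : admissible G -> admissible H ->
  admissible (a%:C *: G + b%:C *: H).
Proof.
move=> hG hH; pose F (i : bool) := if i then G else H.
have hF i : admissible (F i) by case: i; [exact: hG|exact: hH].
have [t t0 ht] := admissible_family hF.
have k0 : 0 < 1 + `|a| + `|b| by rewrite -addrA ltr_pwDl // addr_ge0.
(* This radius keeps both [x * a] and [x * b] within [t]. *)
exists (t / (1 + `|a| + `|b|)) => [|x hx]; first by rewrite divr_gt0.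
have := ht (fun i => x * (if i then a else b)).
rewrite big_bool /= scalerDr !scalerA !rmorphM; apply => i.
rewrite normrM; move: hx; rewrite ler_pdivlMr // => /(le_trans _); apply.
by rewrite ler_wpM2l //; case: i; have := normr_ge0 a; have := normr_ge0 b; lra.
Qed.

Lemma admissible0 : admissible 0.
Proof.
by exists 1 => // x _; rewrite scaler0 addr0; exact: mixed_Block_mean.
Qed.

(** Conjugating the mixture [Block_mean + x G] leaves its first term in place by [Block_mean_Ad]. *)
Lemma admissible_Ad g h G : block_unitary g -> block_unitary h ->
  admissible G -> admissible (Ad g \o G \o Ad h)%VF.
Proof.
move=> hg hh [t t0 ht]; exists t => [|x /ht]; first exact: t0.
move=> /(mixed_Ad hg.1 hh.1).
rewrite comp_lfunDr comp_lfunDl -comp_lfunZr -comp_lfunZl.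
by rewrite (Block_mean_Ad hg).2 (Block_mean_Ad hh).1.
Qed.

(** [Delta] is itself the term of the identity permutation in the mean that gives [Block_mean], with
    weight q. In (1 - x) Phi + x Delta that weight becomes (1 - x) q + x, and the others (1 - x) q;
    all are nonnegative when |x| is at most q. *)
Lemma admissible_Delta : admissible (Delta R d - Block_mean).
Proof.
pose q : R := #|class_perms|%:R^-1.
have q0 : 0 < q by rewrite invr_gt0 ltr0n class_perms_gt0.
have q1 : q <= 1 by rewrite invf_le1 ?ltr0n ?class_perms_gt0 // ler1n class_perms_gt0.
have mq : q * #|class_perms|%:R = 1.
  by rewrite mulVf // pnatr_eq0 -lt0n class_perms_gt0.
exists q => // x hx; pose E s := (Ad (perm_mx s) \o Delta R d \o Ad 1%:M)%VF.
have E1 : Delta R d = E 1%g by rewrite /E perm_mx1 Ad1 comp_lfun1l comp_lfun1r.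
have EB : Block_mean = \sum_s (if s \in class_perms then q else 0 : R)%:C *: E s.
  rewrite Block_mean_perms big_mkcond; apply: eq_bigr => s _.
  by rewrite /E Ad1 comp_lfun1r; case: ifP; rewrite ?scale0r.
have ED : \sum_s ((s == 1%g)%:R : R)%:C *: E s = Delta R d.
  rewrite (bigD1 1%g) //= eqxx scale1r -E1 big1 ?addr0 // => s /negPf ->.
  by rewrite scale0r.
rewrite (_ : _ + _ = \sum_s ((1 - x) * (if s \in class_perms then q else 0) +
    x * (s == 1%g)%:R)%:C *: E s).
  move: hx; rewrite ler_norml => /andP[xl xr]; apply: mixed_convex => [s||s].
  - have x1 : 0 <= 1 - x by lra.
    case: eqP => [->|_]; last by rewrite mulr0 addr0 mulr_ge0 //; case: ifP; rewrite // ltW.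
    have -> : 1%g \in class_perms by apply/class_permsP => i; rewrite perm1.
    by rewrite mulr1; nra.
  - rewrite big_split /= -!mulr_sumr -big_mkcond sumr_const -[q *+ _]mulr_natr mq.
    rewrite (bigD1 1%g) //= eqxx big1 => [|s /negPf -> //].
    by rewrite addr0 !mulr1 subrK.
  - by apply: mixed_Ad; [exact: perm_mx_unitary|exact: unitarymx1|exact: mixed_Delta].
transitivity ((1 - x)%:C *: Block_mean + x%:C *: Delta R d).
  by rewrite rmorphB scalerBl scale1r scalerBr addrA [RHS]addrAC.
rewrite {1}EB -{1}ED 2!scaler_sumr -big_split.
apply: eq_bigr => s _.
by rewrite [in RHS]rmorphD scalerDl !rmorphM !scalerA.
Qed.

End Blocks.

(** * Rank one maps and Hermiticity-preserving maps *)

Section RankOne.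
Variables (R : realType) (d : nat).
Local Notation C := R[i].
Local Notation M := 'M[C]_d.

Definition rank1_fun (H K X : M) : M := \tr (K *m X) *: H.

Fact rank1_linear H K : linear (rank1_fun H K).
Proof.
by move=> a X Y; rewrite /rank1_fun mulmxDr -scalemxAr mxtraceD mxtraceZ scalerDl scalerA.
Qed.

HB.instance Definition _ H K :=
  GRing.isLinear.Build C M M _ (rank1_fun H K) (rank1_linear H K).

Definition rank1 (H K : M) : 'End(M) := linfun (rank1_fun H K).

Lemma rank1E H K X : rank1 H K X = \tr (K *m X) *: H.
Proof. by rewrite lfunE. Qed.

Lemma rank1_linl K a H1 H2 : rank1 (a *: H1 + H2) K = a *: rank1 H1 K + rank1 H2 K.
Proof.
apply/lfunP => X; rewrite add_lfunE scale_lfunE !rank1E scalerDr.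
by rewrite !scalerA mulrC.
Qed.

Lemma rank1_linr H a K1 K2 : rank1 H (a *: K1 + K2) = a *: rank1 H K1 + rank1 H K2.
Proof.
apply/lfunP => X; rewrite add_lfunE scale_lfunE !rank1E mulmxDl -scalemxAl.
by rewrite mxtraceD mxtraceZ scalerDl scalerA.
Qed.

Lemma rank10l K : rank1 0 K = 0.
Proof. by apply/lfunP => X; rewrite rank1E scaler0 zero_lfunE. Qed.

Lemma rank10r H : rank1 H 0 = 0.
Proof. by apply/lfunP => X; rewrite rank1E mul0mx mxtrace0 scale0r zero_lfunE. Qed.

Lemma rank1_Ad g h H K :
  (Ad g \o rank1 H K \o Ad h)%VF = rank1 (Ad g H) (Ad (h^t*) K).
Proof.
apply/lfunP => X; rewrite !comp_lfunE !rank1E linearZ /=; congr (_ *: _).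
by rewrite !AdE trmxCK !mulmxA mxtrace_mulC !mulmxA.
Qed.

Lemma mxtrace_delta_mul i j (X : M) : \tr (delta_mx i j *m X) = X j i.
Proof.
rewrite /mxtrace (bigD1 i) //= big1 ?addr0 => [|k ki].
  rewrite mxE (bigD1 j) //= big1 ?addr0 => [|k kj].
    by rewrite mxE !eqxx mul1r.
  by rewrite mxE eqxx (negPf kj) mul0r.
by rewrite mxE big1 // => l _; rewrite mxE (negPf ki) mul0r.
Qed.

Lemma delta_mx_adj i j : (delta_mx i j : M)^t* = delta_mx j i.
Proof. by apply/matrixP => a b; rewrite !mxE conjC_nat andbC. Qed.

Definition hermitian_map (G : 'End(M)) : Prop := forall X, G (X^t*) = (G X)^t*.

Lemma adjmxD (X Y : M) : (X + Y)^t* = X^t* + Y^t*.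
Proof. by rewrite linearD /= map_mxD. Qed.

Lemma adjmxZ a (X : M) : (a *: X)^t* = Num.conj a *: X^t*.
Proof. by rewrite linearZ /= map_mxZ. Qed.

Lemma adjmx_comb a b (X Y : M) :
  (a *: X + b *: Y)^t* = Num.conj a *: X^t* + Num.conj b *: Y^t*.
Proof. by rewrite adjmxD 2!adjmxZ. Qed.

Lemma adjmxM (X Y : M) : (X *m Y)^t* = Y^t* *m X^t*.
Proof. by rewrite trmx_mul map_mxM. Qed.

Lemma adjmxB (X Y : M) : (X - Y)^t* = X^t* - Y^t*.
Proof. by rewrite -scaleN1r adjmxD adjmxZ rmorphN1 scaleN1r. Qed.

Lemma mxtrace_adj (X : M) : \tr (X^t*) = Num.conj (\tr X).
Proof. by rewrite /mxtrace rmorph_sum; apply: eq_bigr => i _; rewrite !mxE. Qed.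

Lemma conjC_real_complex (a : R) : Num.conj (a%:C) = a%:C.
Proof. exact: conjc_real. Qed.

Lemma hermitian_comb (a b : R) G H : hermitian_map G -> hermitian_map H ->
  hermitian_map (a%:C *: G + b%:C *: H).
Proof.
move=> hG hH X; rewrite 2!add_lfunE 4!scale_lfunE hG hH adjmx_comb.
by rewrite 2!conjC_real_complex.
Qed.

Lemma hermitian0 : hermitian_map 0.
Proof. by move=> X; rewrite !zero_lfunE trmx0 map_mx0. Qed.

Lemma hermitian_rank1 H K : H^t* = H -> K^t* = K -> hermitian_map (rank1 H K).
Proof.
move=> hH hK X; rewrite !rank1E adjmxZ hH -mxtrace_adj adjmxM hK.
by rewrite mxtrace_mulC.
Qed.

Definition diff_mx (i j : 'I_d) : M := delta_mx i i - delta_mx j j.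

Lemma Ad_perm_diff_mx (s : 'S_d) i j :
  Ad (perm_mx s) (diff_mx (s i) (s j)) = diff_mx i j.
Proof.
apply/matrixP => a b; rewrite AdE perm_mx_conjE !mxE.
by rewrite !(inj_eq perm_inj).
Qed.

Lemma diff_mx_adj i j : (diff_mx i j)^t* = diff_mx i j.
Proof. by rewrite adjmxB !delta_mx_adj. Qed.

(** Exchanging two diagonal entries alters only these two, by opposite multiples of their
    difference. *)
Lemma rank1_diff_mx i j : i != j -> rank1 (diff_mx i j) (diff_mx i j) =
  Delta R d - (Ad (perm_mx (tperm i j)) \o Delta R d)%VF.
Proof.
move=> ij; apply/lfunP => X; apply/matrixP => k l.
rewrite rank1E /diff_mx mulmxBl [\tr _]raddfB /= !mxtrace_delta_mul.
transitivity ((X k k - X (tperm i j k) (tperm i j k)) *+ (k == l)); last first.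
  rewrite add_lfunE opp_lfunE comp_lfunE AdE 2![in RHS]mxE perm_mx_conjE.
  by rewrite !Delta_entry (inj_eq perm_inj) mulrnBl.
rewrite !mxE.
have [<-|kl] := eqVneq k l; last first.
  have E (m : 'I_d) : (k == m) && (l == m) = false.
    by apply/negP => /andP[/eqP km /eqP lm]; rewrite km lm eqxx in kl.
  by rewrite !E !mulr0n subr0 mulr0.
rewrite !mulr1n !andbb; case: tpermP => [->|->|].
- by rewrite eqxx (negPf ij) subr0 mulr1.
- by rewrite eqxx eq_sym (negPf ij) sub0r mulrN1 opprB.
- by move=> /eqP/negPf-> /eqP/negPf->; rewrite !subr0 mulr0 subrr.
Qed.

(** * A reflection that produces off-diagonal matrix units *)

Section Reflection.
Variables (A B E F : M) (z : C).
Hypotheses (AA : A *m A = A) (AB : A *m B = B) (AE : A *m E = 0) (AF : A *m F = 0).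
Hypotheses (BA : B *m A = 0) (BB : B *m B = 0) (BE : B *m E = A) (BF : B *m F = B).
Hypotheses (EA : E *m A = E) (EB : E *m B = F) (EE : E *m E = 0) (EF : E *m F = 0).
Hypotheses (FA : F *m A = 0) (FB : F *m B = 0) (FE : F *m E = E) (FF : F *m F = F).
Hypotheses (A_adj : A^t* = A) (B_adj : B^t* = E) (E_adj : E^t* = B) (F_adj : F^t* = F).
Hypothesis z1 : z * Num.conj z = 1.

(* [refl_ket] is w w^* for w = 2 e_k + z e_l, when A, B, E, F are the matrix units
   at (k, k), (k, l), (l, k), (l, l); as w^* w = 5, [refl_mx] is a reflection. *)
Let refl_ket : M := 4 *: A + (2 * Num.conj z) *: B + (2 * z) *: E + F.

Definition refl_mx : M := 1%:M - (2 / 5) *: refl_ket.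

Let mulE := (mulmxDl, mulmxDr, mulNmx, mulmxN, =^~ scalemxAl, =^~ scalemxAr).
Let unitE := (AA, AB, AE, AF, BA, BB, BE, BF, EA, EB, EE, EF, FA, FB, FE, FF).

Let refl_ket_adj : refl_ket^t* = refl_ket.
Proof.
rewrite /refl_ket 3!adjmxD 3!adjmxZ A_adj B_adj E_adj F_adj 2!rmorphM /= conjCK.
by rewrite 2!conjC_nat; congr (_ + _); rewrite addrAC.
Qed.

Let refl_ket_sqr : refl_ket *m refl_ket = 5 *: refl_ket.
Proof.
rewrite /refl_ket !mulE !unitE; apply/matrixP => a b; rewrite !mxE.
by ring: z1.
Qed.

Let refl_ket_diff :
  refl_ket *m (A - F) + (A - F) *m refl_ket = 8 *: A - 2 *: F.
Proof.
rewrite /refl_ket !mulE !unitE; apply/matrixP => a b; rewrite !mxE.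
by ring.
Qed.

(** The scalar 3 = 4 - 1 is the value w^* (A - F) w. *)
Let refl_ket_conj : refl_ket *m (A - F) *m refl_ket = 3 *: refl_ket.
Proof.
have -> : refl_ket *m (A - F) = 8 *: A - 2 *: F - (A - F) *m refl_ket.
  by rewrite -refl_ket_diff addrK.
rewrite mulmxBl -(mulmxA (A - F)) refl_ket_sqr /refl_ket !mulE !unitE !(scalerDr, scalerA).
by apply/matrixP => a b; rewrite !mxE; ring.
Qed.

Let refl_mx_adj : refl_mx^t* = refl_mx.
Proof.
rewrite /refl_mx adjmxB adjmxZ refl_ket_adj trmx1 map_mx1.
by rewrite fmorph_div /= !conjC_nat.
Qed.

Lemma refl_mx_unitary : refl_mx \is unitarymx.
Proof.
apply/unitarymxP; rewrite refl_mx_adj /refl_mx mulmxBl mul1mx mulmxBr mulmx1.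
rewrite -scalemxAl -scalemxAr refl_ket_sqr.
by apply/matrixP => a b; rewrite !mxE; field.
Qed.

(** The vector w has unequal moduli in its two coordinates, so the image has both a diagonal and an
    off-diagonal part. The nonzero coefficient 24 / 25 allows the latter to be isolated. Only w w^*
    / 5 enters, so no square root is needed. *)
Lemma Ad_refl_mx : Ad refl_mx (A - F) =
  (- 7 / 25) *: (A - F) + (24 / 25) *: (Num.conj z *: B + z *: E).
Proof.
rewrite AdE refl_mx_adj /refl_mx.
have -> : (1%:M - (2 / 5) *: refl_ket) *m (A - F) *m (1%:M - (2 / 5) *: refl_ket) =
    (A - F) - (2 / 5) *: (refl_ket *m (A - F) + (A - F) *m refl_ket) +
    (4 / 25) *: (refl_ket *m (A - F) *m refl_ket).
  rewrite (mulmxBl 1%:M) mulmxBr mul1mx mulmx1 mulmxBl -!(scalemxAl, scalemxAr).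
  move: (refl_ket *m (A - F) *m refl_ket) => U.
  move: (refl_ket *m (A - F)) ((A - F) *m refl_ket) => V W.
  by apply/matrixP => a b; rewrite !mxE; field.
rewrite refl_ket_diff refl_ket_conj /refl_ket !(scalerDr, scalerBr, scalerA).
by apply/matrixP => a b; rewrite !mxE; field.
Qed.

End Reflection.

(** * Complex combinations of admissible directions *)

Section Admissible.
Variables (T : eqType) (kappa : 'I_d -> T).

(** Off-diagonal matrix units are reached only with complex coefficients, whereas admissibility is a
    real notion. Hermiticity of both components is recorded so that the real part can be separated
    again by [hermitian_imaginary]. *)
Definition admissibleC (F : 'End(M)) : Prop :=
  exists G1 G2, [/\ admissible kappa G1, admissible kappa G2, hermitian_map G1,
    hermitian_map G2 & F = G1 + 'i%C *: G2].

Lemma complex_scale_rect (V : lmodType C) c (F1 F2 : V) :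
  c *: (F1 + 'i%C *: F2) =
  ((complex.Re c)%:C *: F1 + (- complex.Im c)%:C *: F2) +
  'i%C *: ((complex.Im c)%:C *: F1 + (complex.Re c)%:C *: F2).
Proof.
have ii : 'i%C * 'i%C = -1 :> C by rewrite -expr2 sqr_i.
rewrite [in LHS](complexE c); move: (complex.Re c) (complex.Im c) => a b.
rewrite !(scalerDr, scalerDl, scalerA) rmorphN /=.
rewrite (mulrAC 'i%C) ii mulN1r (mulrC a%:C) (addrC (('i%C * a%:C) *: F2)).
by rewrite [LHS]addrACA.
Qed.

Lemma complex_lin_rect (V : lmodType C) c (F1 F2 G1 G2 : V) :
  c *: (F1 + 'i%C *: F2) + (G1 + 'i%C *: G2) =
  1%:C *: ((complex.Re c)%:C *: F1 + (- complex.Im c)%:C *: F2) + 1%:C *: G1 +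
  'i%C *: (1%:C *: ((complex.Im c)%:C *: F1 + (complex.Re c)%:C *: F2) + 1%:C *: G2).
Proof. by rewrite complex_scale_rect !scale1r (scalerDr 'i%C (_ + _)) addrACA. Qed.

Lemma admissibleC_lin c F G : admissibleC F -> admissibleC G ->
  admissibleC (c *: F + G).
Proof.
move=> [F1 [F2 [aF1 aF2 hF1 hF2 ->]]] [G1 [G2 [aG1 aG2 hG1 hG2 ->]]].
pose a := complex.Re c; pose b := complex.Im c.
exists (1%:C *: (a%:C *: F1 + (- b)%:C *: F2) + 1%:C *: G1).
exists (1%:C *: (b%:C *: F1 + a%:C *: F2) + 1%:C *: G2).
split.
- exact: (admissible_comb 1 1 (admissible_comb a (- b) aF1 aF2) aG1).
- exact: (admissible_comb 1 1 (admissible_comb b a aF1 aF2) aG2).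
- exact: (hermitian_comb 1 1 (hermitian_comb a (- b) hF1 hF2) hG1).
- exact: (hermitian_comb 1 1 (hermitian_comb b a hF1 hF2) hG2).
exact: complex_lin_rect.
Qed.

Lemma admissibleC0 : admissibleC 0.
Proof.
exists 0, 0; split; rewrite ?scaler0 ?addr0 //; solve [exact: admissible0|exact: hermitian0].
Qed.

Definition conj_diff (c : T) (H : M) : Prop :=
  exists g k l, [/\ block_unitary kappa g, k != l, kappa k = c, kappa l = c &
    H = Ad g (diff_mx k l)].

(** The class permutations act doubly transitively on a class: a first transposition sends i to k,
    and a second one sends the image of j to l without moving k. *)
Lemma class_transitive2 k l i j : kappa k = kappa i -> kappa l = kappa i ->
  kappa j = kappa i -> k != l -> i != j ->
  exists2 s : 'S_d, s \in class_perms kappa & s i = k /\ s j = l.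
Proof.
move=> ki li ji kl ij; pose j' := tperm i k j.
have t1 : tperm i k \in class_perms kappa by exact: tperm_class.
have j'i : kappa j' = kappa i by rewrite (class_permsP _ _ t1) ji.
exists (tperm i k * tperm j' l)%g.
  by apply: class_permsM => //; apply: tperm_class; rewrite j'i.
rewrite !permM tpermL -/j' tpermL tpermD //; last by rewrite eq_sym.
by apply/eqP => j'k; case/eqP: ij; apply: (@perm_inj _ (tperm i k)); rewrite tpermL -/j'.
Qed.

(* Conjugating by a permutation makes the two differences equal, and
   [rank1 Z Z = Delta - Ad_s Delta] for Z a difference of diagonal units. *)
Lemma admissibleC_conj_diff c H K : conj_diff c H -> conj_diff c K ->
  admissibleC (rank1 H K).
Proof.
move=> [g [k [l [hg kl kc lc ->]]]] [h [i [j [hh ij ic jc ->]]]].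
have herm u m n : (Ad u (diff_mx m n))^t* = Ad u (diff_mx m n).
  by rewrite !AdE !adjmxM diff_mx_adj trmxCK mulmxA.
have [s sP [<- <-]] : exists2 s : 'S_d, s \in class_perms kappa & s k = i /\ s l = j.
  by apply: class_transitive2; rewrite ?kc ?lc ?ic ?jc.
exists (rank1 (Ad g (diff_mx k l)) (Ad h (diff_mx (s k) (s l)))), 0; split.
- have -> : Ad h (diff_mx (s k) (s l)) = Ad (h *m (perm_mx s)^t*) (diff_mx k l).
    rewrite -Ad_comp comp_lfunE; congr (Ad h _).
    by rewrite perm_mx_adj -[LHS](@Ad_perm_diff_mx s^-1) !permK.
  rewrite -[h *m _]trmxCK -rank1_Ad rank1_diff_mx //.
  apply: admissible_Ad => //.
    apply/block_unitary_adj/block_unitaryM => //.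
    exact/block_unitary_adj/perm_block_unitary.
  have aD := admissible_Delta R kappa.
  have tP : tperm k l \in class_perms kappa by apply: tperm_class; rewrite kc lc.
  (* With s the transposition, [Ad_s] fixes the block mean, so [Delta - Ad_s Delta] is (Delta - Phi)
     - Ad_s (Delta - Phi). *)
  have := admissible_comb 1 (-1) aD
    (admissible_Ad (perm_block_unitary R tP) (block_unitary1 R kappa) aD).
  rewrite scale1r rmorphN1 scaleN1r Ad1 comp_lfun1r comp_lfunDr.
  have /Block_mean_Ad[_ BT] := perm_block_unitary R tP.
  by rewrite comp_lfunNr BT opprB addrA subrK.
- exact: admissible0.
- by apply: hermitian_rank1.
- exact: hermitian0.
- by rewrite scaler0 addr0.
Qed.

End Admissible.
End RankOne.

(** * A neighbourhood of the block mean inside the mixtures *)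

Section Span.
Variables (R : realType) (d : nat) (T : eqType) (kappa : 'I_d -> T).
Local Notation C := R[i].
Local Notation M := 'M[C]_d.
Local Notation Phi := (Block_mean R kappa).

Lemma Block_mean_delta_neq k l : k != l -> Phi (delta_mx k l) = 0.
Proof.
move=> kl; apply/matrixP => a b; rewrite Block_meanE big1 => [|j _].
  by rewrite mul0r mul0rn mxE.
by rewrite mxE; case: eqP => // ->; rewrite (negPf kl).
Qed.

Lemma Block_mean_delta k : Phi (delta_mx k k) =
  (#|[pred j | kappa j == kappa k]|%:R^-1) *: \sum_(j | kappa j == kappa k) delta_mx j j.
Proof.
apply/matrixP => a b; rewrite Block_meanE [RHS]mxE summxE.
have [ak|ak] := eqVneq (kappa a) (kappa k); last first.
  rewrite !big1 ?mul0r ?mul0rn ?mulr0 // => j jc.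
    rewrite mxE; case: eqP => //= ja; move: ak; rewrite ja.
    by rewrite (eqP jc) eqxx.
  by rewrite mxE; case: eqP => // jk; move: ak; rewrite -jk (eqP jc) eqxx.
rewrite ak (bigD1 k) //= [X in _ + X]big1 => [|j /andP[_ /negPf jk]]; last first.
  by rewrite mxE jk.
rewrite (bigD1 a) ?ak //= [X in _ = _ * (_ + X)]big1 => [|j /andP[_ ja]]; last first.
  by rewrite mxE eq_sym (negPf ja).
by rewrite !mxE !eqxx !addr0 mul1r /= eq_sym -mulr_natr.
Qed.

(** Diagonal units are handled by averaging differences over the class, off-diagonal ones by the
    reflection. Quantifying over an arbitrary subspace [S] lets the result serve in either argument
    of [rank1]. *)
Lemma conj_diff_span c (S : M -> Prop) : S 0 ->
  (forall a H K, S H -> S K -> S (a *: H + K)) ->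
  (forall H, conj_diff kappa c H -> S H) ->
  forall k l, kappa k = c -> kappa l = c -> S (delta_mx k l - Phi (delta_mx k l)).
Proof.
move=> S0 Slin Sdiff k l kc lc.
have Sscale a H : S H -> S (a *: H) by move=> SH; rewrite -[_ *: _]addr0; exact: Slin.
have SD H K : S H -> S K -> S (H + K) by rewrite -{2}[H]scale1r; exact: Slin.
have Sdiag i j : i != j -> kappa i = c -> kappa j = c -> S (diff_mx R i j).
  move=> ij ic jc; apply: Sdiff; exists 1%:M, i, j; split => //.
    exact: block_unitary1.
  by rewrite Ad1 lfunE.
have [<-|kl] := eqVneq k l.
  rewrite Block_mean_delta.
  (* Written as an average of copies of itself, the unit minus its block mean becomes an average of
     the matrices [diff_mx k j]. *)
  have -> : delta_mx k k = #|[pred j | kappa j == kappa k]|%:R^-1 *: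
      \sum_(j | kappa j == kappa k) delta_mx k k :> M.
    rewrite sumr_const -[delta_mx k k *+ _]scaler_nat scalerA mulVf ?scale1r //.
    exact: class_card_neq0.
  rewrite -scalerBr -sumrB; apply: Sscale; elim/big_ind: _ => // j /eqP jc.
  have [<-|jk] := eqVneq k j; first by rewrite subrr.
  by apply: Sdiag => //; rewrite jc.
rewrite Block_mean_delta_neq // subr0.
have Srefl z : z * Num.conj z = 1 -> S (Num.conj z *: delta_mx k l + z *: delta_mx l k).
  move=> z1.
  have Z0 (i j a b : 'I_d) : a != b -> delta_mx i a *m delta_mx b j = 0 :> M.
    exact: mul_delta_mx_0.
  have lk : l != k by rewrite eq_sym.
  have E := @Ad_refl_mx R d (delta_mx k k) (delta_mx k l) (delta_mx l k) (delta_mx l l) z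
    (mul_delta_mx _ _ _) (mul_delta_mx _ _ _) (Z0 _ _ _ _ kl) (Z0 _ _ _ _ kl)
    (Z0 _ _ _ _ lk) (Z0 _ _ _ _ lk) (mul_delta_mx _ _ _) (mul_delta_mx _ _ _)
    (mul_delta_mx _ _ _) (mul_delta_mx _ _ _) (Z0 _ _ _ _ kl) (Z0 _ _ _ _ kl)
    (Z0 _ _ _ _ lk) (Z0 _ _ _ _ lk) (mul_delta_mx _ _ _) (mul_delta_mx _ _ _)
    (delta_mx_adj _ _ _) (delta_mx_adj _ _ _) (delta_mx_adj _ _ _) (delta_mx_adj _ _ _) z1.
  have U := @refl_mx_unitary R d (delta_mx k k) (delta_mx k l) (delta_mx l k) (delta_mx l l) z
    (mul_delta_mx _ _ _) (mul_delta_mx _ _ _) (Z0 _ _ _ _ kl) (Z0 _ _ _ _ kl)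
    (Z0 _ _ _ _ lk) (Z0 _ _ _ _ lk) (mul_delta_mx _ _ _) (mul_delta_mx _ _ _)
    (mul_delta_mx _ _ _) (mul_delta_mx _ _ _) (Z0 _ _ _ _ kl) (Z0 _ _ _ _ kl)
    (Z0 _ _ _ _ lk) (Z0 _ _ _ _ lk) (mul_delta_mx _ _ _) (mul_delta_mx _ _ _)
    (delta_mx_adj _ _ _) (delta_mx_adj _ _ _) (delta_mx_adj _ _ _) (delta_mx_adj _ _ _) z1.
  set g := refl_mx _ _ _ _ _ in E U.
  have gb : block_unitary kappa g.
    split=> // a b ab.
    have D0 i j : kappa i = c -> kappa j = c -> delta_mx i j a b = 0 :> C.
      move=> ic jc; rewrite mxE; case: eqP => //= ai; case: eqP => //= bj.
      by move: ab; rewrite ai bj ic jc eqxx.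
    have I0 : (1%:M : M) a b = 0.
      by rewrite mxE; case: (eqVneq a b) => // e; rewrite e eqxx in ab.
    rewrite /g /refl_mx.
    have mxEs : forall X Y : M, ((X + Y) a b = X a b + Y a b) * ((- X) a b = - X a b) *
        (forall x, (x *: X) a b = x * X a b).
      by move=> X Y; split; [split|move=> x]; rewrite mxE.
    rewrite (mxEs _ _).1.1 I0 (mxEs _ 0).1.2 (mxEs _ 0).2 3!(mxEs _ _).1.1.
    by rewrite 3!(mxEs _ 0).2 !D0 // !mulr0 !addr0 mulr0 oppr0 addr0.
  have Sg : S (Ad g (diff_mx R k l)).
    by apply: Sdiff; exists g, k, l; split.
  (* This solves [Ad_refl_mx] for the off-diagonal part. *)
  have -> : Num.conj z *: delta_mx k l + z *: delta_mx l k =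
      (25 / 24) *: (Ad g (diff_mx R k l) + (7 / 25) *: diff_mx R k l).
    rewrite E -/(diff_mx R k l); move: (_ + z *: _) => W.
    rewrite addrAC -scalerDl mulNr addNr scale0r add0r scalerA.
    rewrite (_ : 25 / 24 * (24 / 25) = 1 :> C) ?scale1r //; by field.
  exact: Sscale (SD _ _ Sg (Sscale _ _ (Sdiag _ _ kl kc lc))).
have i1 : 'i%C * Num.conj 'i%C = 1 :> C by simpc.
(* Polarization with z = 1 and z = 'i: the terms in [delta_mx l k] cancel. *)
have -> : delta_mx k l = (1 / 2) *: ((Num.conj 1 *: delta_mx k l + 1 *: delta_mx l k) +
    'i%C *: (Num.conj 'i%C *: delta_mx k l + 'i%C *: delta_mx l k)) :> M.
  rewrite conjC1 !scale1r (scalerDr 'i%C) !scalerA i1 -expr2 sqr_i scale1r scaleN1r.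
  rewrite addrACA subrr addr0 -mulr2n -[delta_mx k l *+ _]scaler_nat.
  rewrite scalerA mul1r mulVf ?scale1r //.
  by rewrite pnatr_eq0.
have c1 : 1 * Num.conj 1 = 1 :> C by rewrite conjC1 mulr1.
exact: Sscale (SD _ _ (Srefl _ c1) (Sscale _ _ (Srefl _ i1))).
Qed.

(** [rank1] is bilinear, so [conj_diff_span] is applied first to the left argument, against every
    conjugated difference on the right, and then to the right argument. *)
Lemma admissibleC_rank1 k l i j : kappa k = kappa l -> kappa i = kappa l ->
  kappa j = kappa l ->
  admissibleC kappa (rank1 (delta_mx k l - Phi (delta_mx k l))
                           (delta_mx i j - Phi (delta_mx i j))).
Proof.
move=> kl il jl.
pose S (H : M) := forall K : M, conj_diff kappa (kappa l) K -> admissibleC kappa (rank1 H K).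
have SH : S (delta_mx k l - Phi (delta_mx k l)).
  apply: (@conj_diff_span (kappa l)) => //.
  - by move=> K _; rewrite rank10l; exact: admissibleC0.
  - by move=> a H1 H2 h1 h2 K hK; rewrite rank1_linl; apply: admissibleC_lin; auto.
  - by move=> H hH K hK; exact: admissibleC_conj_diff hH hK.
apply: (@conj_diff_span (kappa l) (fun K => admissibleC kappa (rank1 _ K))) => //.
- by rewrite rank10r; exact: admissibleC0.
- by move=> a K1 K2 h1 h2; rewrite rank1_linr; exact: admissibleC_lin.
Qed.

(** This is self-adjointness of the block mean for the pairing tr(Y X), tested on matrix units. *)
Lemma mxtrace_Block_mean_delta i j (X : M) :
  \tr (Phi (delta_mx j i) *m X) = Phi X i j.
Proof.
rewrite Block_meanE; have [<-|ij] := eqVneq i j; last first.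
  by rewrite Block_mean_delta_neq 1?eq_sym // mul0mx mxtrace0 mulr0n.
rewrite Block_mean_delta -scalemxAl mxtraceZ mulmx_suml raddf_sum /=.
rewrite mulr1n mulrC (eq_bigr (fun k => X k k)) // => k _.
by rewrite mxtrace_delta_mul.
Qed.

(** The hypotheses give D = Q D Q for Q = 1 - Phi. Expanding the input and the output of the inner D
    in matrix units leaves Q on the output units; on the input side Q moves inside the trace because
    Phi is self-adjoint. *)
Lemma rank1_decomposition (D : 'End(M)) : (D \o Phi = 0)%VF -> (Phi \o D = 0)%VF ->
  D = \sum_(a : ('I_d * 'I_d) * ('I_d * 'I_d))
    D (delta_mx a.1.1 a.1.2) a.2.1 a.2.2 *:
    rank1 (delta_mx a.2.1 a.2.2 - Phi (delta_mx a.2.1 a.2.2))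
          (delta_mx a.1.2 a.1.1 - Phi (delta_mx a.1.2 a.1.1)).
Proof.
move=> DPhi PhiD; pose Q := (\1 - Phi)%VF.
have QE X : X - Phi X = Q X by rewrite add_lfunE opp_lfunE id_lfunE.
have sum_delta (A : M) : A = \sum_(p : 'I_d * 'I_d) A p.1 p.2 *: delta_mx p.1 p.2.
  by rewrite {1}[A]matrix_sum_delta pair_bigA.
have DQ : (Q \o D \o Q)%VF = D.
  rewrite /Q comp_lfunDl comp_lfunNl comp_lfun1l PhiD subr0.
  by rewrite comp_lfunDr comp_lfunNr comp_lfun1r DPhi subr0.
apply/lfunP => X; rewrite -[in LHS]DQ 2!comp_lfunE sum_lfunE.
rewrite [in LHS](sum_delta (Q X)) !linear_sum /=.
rewrite -(pair_bigA _ (fun p q => ((D (delta_mx p.1 p.2)) q.1 q.2 *: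
  rank1 (delta_mx q.1 q.2 - Phi (delta_mx q.1 q.2))
        (delta_mx p.2 p.1 - Phi (delta_mx p.2 p.1))) X)) /=.
apply: eq_bigr => -[i j] _ /=; rewrite !linearZ /= [in LHS](sum_delta (D _)).
rewrite linear_sum scaler_sumr; apply: eq_bigr => -[k l] _ /=.
rewrite linearZ scale_lfunE rank1E mulmxBl [\tr _]raddfB /= mxtrace_delta_mul.
by rewrite mxtrace_Block_mean_delta QE !scalerA mulrC -QE mxE [X in _ + X]mxE.
Qed.

Lemma hermitian_sum (I : finType) (x : I -> R) (G : I -> 'End(M)) :
  (forall i, hermitian_map (G i)) -> hermitian_map (\sum_i (x i)%:C *: G i).
Proof.
move=> hG; elim/big_ind: _ => [|F1 F2 h1 h2|i _]; first exact: hermitian0.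
  by have := hermitian_comb 1 1 h1 h2; rewrite !scale1r.
by have := hermitian_comb (x i) 0 (hG i) (@hermitian0 R d); rewrite scaler0 addr0.
Qed.

Lemma hermitian_imaginary (F : 'End(M)) :
  hermitian_map F -> hermitian_map ('i%C *: F) -> F = 0.
Proof.
move=> hF hiF; apply/lfunP => X; rewrite zero_lfunE -[F X]trmxCK.
have := hiF X; rewrite 2!scale_lfunE adjmxZ hF.
move: ((F X)^t*) => Y.
have -> : Num.conj 'i%C = - 'i%C :> C by apply/eqP; rewrite eq_complex /= oppr0 !eqxx.
move=> /eqP; rewrite scaleNr -addr_eq0 -mulr2n -scaler_nat scalerA scaler_eq0.
rewrite mulf_eq0 pnatr_eq0 /= eq_complex /= eqxx oner_eq0 /= => /eqP ->.
by rewrite trmx0 map_mx0.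
Qed.

Lemma mixed_near_Block_mean : exists2 t : R, 0 < t & forall D : 'End(M),
  hermitian_map D -> (D \o Phi = 0)%VF -> (Phi \o D = 0)%VF ->
  (forall i j k l, D (delta_mx i j) k l != 0 ->
     [/\ kappa k = kappa l, kappa i = kappa l & kappa j = kappa l]) ->
  (forall i j k l, `|D (delta_mx i j) k l| <= t%:C) ->
  mixed_twisted_dephasing (Phi + D).
Proof.
pose I := (('I_d * 'I_d) * ('I_d * 'I_d))%type.
pose same (a : I) := [&& kappa a.2.1 == kappa a.2.2, kappa a.1.1 == kappa a.2.2 &
  kappa a.1.2 == kappa a.2.2].
pose B (a : I) := rank1 (delta_mx a.2.1 a.2.2 - Phi (delta_mx a.2.1 a.2.2))
  (delta_mx a.1.2 a.1.1 - Phi (delta_mx a.1.2 a.1.1)).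
(* Index quadruples that are not in one class receive the pair (0, 0), so that the choice is total;
   their coefficients in [D] vanish. *)
have aB a : exists G : 'End(M) * 'End(M), [/\ admissible kappa G.1, admissible kappa G.2,
    hermitian_map G.1, hermitian_map G.2 & same a -> B a = G.1 + 'i%C *: G.2].
  case: (boolP (same a)) => [/and3P[/eqP e1 /eqP e2 /eqP e3]|_].
    have [G1 [G2 [a1 a2 h1 h2 GE]]] := admissibleC_rank1 e1 e3 e2; exists (G1, G2).
    by split=> [||||_]; [exact: a1|exact: a2|exact: h1|exact: h2|exact: GE].
  by exists (0, 0); split => //; solve [exact: admissible0|exact: hermitian0].
have {aB}[G hG] := choice aB.
have [|t t0 ht] := @admissible_family R d T kappa (I + I)%type
    (fun s => match s with inl a => (G a).1 | inr a => (G a).2 end).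
  by case=> a; case: (hG a).
exists t => // D hD DPhi PhiD supp bound.
pose c (a : I) := D (delta_mx a.1.1 a.1.2) a.2.1 a.2.2.
pose E := \sum_a (complex.Re (c a))%:C *: (G a).1 +
  \sum_a (- complex.Im (c a))%:C *: (G a).2.
pose F := \sum_a (complex.Im (c a))%:C *: (G a).1 +
  \sum_a (complex.Re (c a))%:C *: (G a).2.
have herm x y : hermitian_map (\sum_a (x a)%:C *: (G a).1 + \sum_a (y a)%:C *: (G a).2).
  have h1 : hermitian_map (\sum_a (x a)%:C *: (G a).1).
    by apply: hermitian_sum => a; case: (hG a).
  have h2 : hermitian_map (\sum_a (y a)%:C *: (G a).2).
    by apply: hermitian_sum => a; case: (hG a).
  by have := hermitian_comb 1 1 h1 h2; rewrite !scale1r.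
(* [E] and [F] collect the real and imaginary parts of each c (G1 + 'i G2). *)
have DE : D = E + 'i%C *: F.
  rewrite [LHS](rank1_decomposition DPhi PhiD) /E /F -!big_split /= scaler_sumr -big_split.
  apply: eq_bigr => a _ /=; rewrite -/(c a) -/(B a).
  rewrite -(@complex_scale_rect R _ (c a) (G a).1 (G a).2).
  have [c0|c0] := eqVneq (c a) 0; first by rewrite c0 !scale0r.
  case: (hG a) => _ _ _ _ -> //; case: (supp _ _ _ _ c0) => e1 e2 e3.
  by apply/and3P; split; apply/eqP.
have F0 : F = 0.
  apply: hermitian_imaginary; first exact: herm.
  have -> : 'i%C *: F = D - E by rewrite DE addrC addKr.
  have := hermitian_comb 1 (-1) hD (herm _ _ : hermitian_map E).
  by rewrite rmorphN1 scaleN1r scale1r.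
rewrite DE F0 scaler0 addr0.
have := ht (fun s => match s with inl a => complex.Re (c a) | inr a => - complex.Im (c a) end).
rewrite big_sumType; apply => -[a|a].
- by rewrite -lecR; exact: le_trans (normc_ge_Re _) (bound _ _ _ _).
(* The coefficient - Im c is the real part of c 'i, which has the same modulus as c. *)
- rewrite -ReiNIm -lecR; apply: le_trans (normc_ge_Re _) _.
  have -> : `|c a * 'i%C| = `|c a|.
    by rewrite normrM (normc_def 'i%C) /= expr0n expr1n add0r sqrtr1 mulr1.
  exact: bound.
Qed.

End Span.

(** * Coordinates are bounded by any norm on a finite-dimensional real space *)

Module SphereCompactness.
Import classical_sets functions topology normedtype derive.
Import numFieldNormedType.Exports.

(** Subadditivity and evenness give |g x - g y| <= g (x - y) <= L |x - y|. *)
Lemma sublinear_continuous (R : realType) (V : normedModType R) (g : V -> R) (L : R) :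
  (forall x y, g (x + y) <= g x + g y) -> (forall x, g (- x) = g x) -> 0 < L ->
  (forall x, g x <= L * `|x|) -> continuous g.
Proof.
move=> gD gN L0 gL x; apply/cvgrPdist_lt => e e0; near=> y.
apply: (@le_lt_trans _ _ (L * `|x - y|)).
  apply: le_trans (gL _); rewrite ler_norml; apply/andP; split.
    have := gD (y - x) x; rewrite subrK -opprB gN; lra.
  by have := gD (x - y) y; rewrite subrK; lra.
rewrite -ltr_pdivlMl // mulrC; near: y.
by apply: cvgr_dist_lt; [exact: cvg_id|exact: divr_gt0].
Unshelve. all: by end_near.
Qed.

(** The continuous function g attains a minimum on the compact unit sphere of the sup norm. It is
    positive by definiteness, and its inverse is the constant sought. *)
Lemma sublinear_coord_bound (R : realType) (n : nat) (g : 'rV[R]_n -> R) :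
  (forall x y, g (x + y) <= g x + g y) -> (forall a x, g (a *: x) = `|a| * g x) ->
  (forall x, g x = 0 -> x = 0) ->
  exists2 K : R, 0 < K & forall (x : 'rV[R]_n) i, `|x ord0 i| <= K * g x.
Proof.
move=> gD gZ g0.
have gzero : g 0 = 0 by rewrite -(scale0r 0) gZ normr0 mul0r.
have gN x : g (- x) = g x by rewrite -scaleN1r gZ normrN1 mul1r.
have gpos x : 0 <= g x.
  have := gD x (- x); rewrite subrr gzero gN -mulr2n => h.
  by rewrite -(@pmulrn_lge0 _ _ 2).
have xi (x : 'rV[R]_n) i : `|x ord0 i| <= `|x|.
  rewrite {2}/Num.norm /= mx_normrE.
  exact: (@le_bigmax _ _ _ 0 (fun ij => `|x ij.1 ij.2|) (ord0, i)).
pose L := 1 + \sum_j g (delta_mx ord0 j).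
have L0 : 0 < L by rewrite ltr_pwDl // sumr_ge0.
have gL x : g x <= L * `|x|.
  apply: (@le_trans _ _ (\sum_j `|x ord0 j| * g (delta_mx ord0 j))).
    rewrite {1}(row_sum_delta x); elim/big_ind2: _ => [|a b c e h1 h2|j _].
    - by rewrite gzero.
    - exact: le_trans (gD _ _) (lerD h1 h2).
    - by rewrite gZ.
  rewrite /L mulrDl mul1r mulr_suml -[leLHS]add0r lerD // ler_sum // => j _.
  by rewrite mulrC ler_wpM2l.
have gcont : continuous g by exact: sublinear_continuous gL.
pose A := [set x : 'rV[R]_n | `|x| = 1].
have Acompact : compact A.
  apply: bounded_closed_compact.
    by exists 1; split => // M M1 x /= ->; exact: ltW.
  rewrite (_ : A = (fun x : 'rV[R]_n => `|x|) @^-1` [set 1]) //.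
  apply: preimage_closed => [x _|]; [exact: norm_continuous|exact: closed_eq].
have normA x : x != 0 -> A (`|x|^-1 *: x).
  by move=> x0; rewrite /A /= normrZ normfV normr_id mulVf // normr_eq0.
(* If the sphere is empty, every vector is zero and any constant works. *)
have [A0|A0] := pselect (A !=set0); last first.
  exists 1 => // x i; have [->|x0] := eqVneq x 0.
    by rewrite mxE normr0 gzero mulr0.
  by case: A0; exists (`|x|^-1 *: x); exact: normA.
have [|c cA cmin] := compact_EVT_min A0 Acompact (f := g).
  exact: continuous_subspaceT.
have gc : 0 < g c.
  rewrite lt_neqAle gpos andbT eq_sym; apply/eqP => /g0 c0.
  by move: cA; rewrite inE /A /= c0 normr0 => /eqP; rewrite eq_sym oner_eq0.
exists (g c)^-1 => [|x i]; first by rewrite invr_gt0.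
apply: le_trans (xi x i) _; rewrite mulrC ler_pdivlMr //.
have [->|x0] := eqVneq x 0; first by rewrite normr0 mul0r gzero.
have := cmin _ (mem_set (normA _ x0)).
by rewrite gZ ger0_norm ?invr_ge0 // mulrC ler_pdivlMr ?normr_gt0 // mulrC.
Qed.

End SphereCompactness.

(** * Boundedness of complex linear functionals for an arbitrary norm *)

Section NormBound.
Variables (R : realType) (V : vectType R[i]).
Local Notation C := R[i].

Lemma is_norm_ge0 (N : V -> R) : is_norm N -> forall v, 0 <= N v.
Proof.
move=> [_ NZ ND] v.
have NN : N (- v) = N v by apply: complexI; rewrite -scaleN1r NZ normrN1 mul1r.
have N00 : N 0 = 0 by apply: complexI; rewrite -(scale0r 0) NZ normr0 mul0r.
by have := ND v (- v); rewrite subrr N00 NN; lra.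
Qed.

Lemma linear_functional_bound (N : V -> R) (l : {linear V -> C^o}) : is_norm N ->
  exists2 K : R, 0 < K & forall v, `|l v| <= (K * N v)%:C.
Proof.
move=> N_norm; have [N0 NZ ND] := N_norm.
pose n := \dim {:V}; pose b i := (vbasis {:V})`_i.
(* Real and imaginary parts of the coordinates identify the space with a real one of dimension 2n,
   where [N \o w] is a real norm. *)
pose z (x : 'rV[R]_(n + n)) (i : 'I_n) : C :=
  (x ord0 (lshift n i))%:C + 'i%C * (x ord0 (rshift n i))%:C.
pose w x := \sum_i z x i *: b i.
have wD x y : w (x + y) = w x + w y.
  rewrite /w -big_split; apply: eq_bigr => i _ /=.
  by rewrite -scalerDl /z !mxE !rmorphD mulrDr addrACA.
have wZ a x : w (a *: x) = a%:C *: w x.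
  rewrite /w scaler_sumr; apply: eq_bigr => i _ /=.
  by rewrite scalerA /z !mxE !rmorphM mulrDr (mulrCA 'i%C).
have zw x i : z x i = coord (vbasis {:V}) i (w x).
  by rewrite coord_sum_free // (basis_free (vbasisP _)).
have zReIm x i : complex.Re (z x i) = x ord0 (lshift n i) /\
    complex.Im (z x i) = x ord0 (rshift n i).
  by rewrite /z /=; split; simpc; rewrite /= ?addr0 ?add0r.
have [|||K K0 hK] := @SphereCompactness.sublinear_coord_bound R _ (N \o w).
- by move=> x y /=; rewrite wD ND.
- move=> a x /=; rewrite wZ; apply: complexI; rewrite NZ rmorphM; congr (_ * _).
  by rewrite normc_def /= expr0n addr0 sqrtr_sqr.
- move=> x /N0 wx; have z0 i : z x i = 0 by rewrite zw wx linear0.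
  apply/rowP => j; rewrite mxE -(splitK j).
  by case: (split j) => i; have [h1 h2] := zReIm x i; [rewrite -h1|rewrite -h2]; rewrite z0.
have bound v i : `|coord (vbasis {:V}) i v| <= (2 * K * N v)%:C.
  pose c j := coord (vbasis {:V}) j v.
  pose x := row_mx (\row_j complex.Re (c j)) (\row_j complex.Im (c j)) : 'rV[R]_(n + n).
  have zx j : z x j = c j.
    by rewrite /z /x row_mxEl row_mxEr !mxE -complexE.
  have wx : w x = v.
    rewrite /w; under eq_bigr do rewrite zx.
    by rewrite -coord_vbasis ?memvf.
  rewrite -/(c i) -zx /z (le_trans (ler_normD _ _)) // normrM.
  have normR (a : R) : `|a%:C| = `|a|%:C.
    by rewrite normc_def /= expr0n addr0 sqrtr_sqr.
  rewrite (normc_def 'i%C) /= expr0n expr1n add0r sqrtr1 mul1r !normR -rmorphD lecR.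
  have := hK x (lshift n i); have := hK x (rshift n i); rewrite /= wx; lra.
(* The real part only brings the modulus, which lives in R[i], back to [R]; the 1 makes [B]
   positive. *)
pose B := 1 + \sum_(i < n) complex.Re `|l (b i)|.
have Nv := is_norm_ge0 N_norm.
have B0 : 0 < B.
  rewrite ltr_pwDl // sumr_ge0 // => i _.
  by have := normr_ge0 (l (b i)); rewrite lecE => /andP[].
exists (2 * K * B) => [|v]; first by rewrite !mulr_gt0.
rewrite {1}(coord_vbasis (memvf v)) linear_sum (le_trans (ler_norm_sum _ _ _)) //.
have -> : (2 * K * B * N v)%:C = (2 * K * N v)%:C + \sum_(i < n) (2 * K * N v)%:C * `|l (b i)|.
  rewrite -mulr_sumr /B.
  have -> : \sum_(i < n) `|l (b i)| = (\sum_(i < n) complex.Re `|l (b i)|)%:C.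
    by rewrite rmorph_sum; apply: eq_bigr => i _; exact/esym/RRe_real/normr_real.
  by rewrite -rmorphM -rmorphD; congr (_%:C); ring.
rewrite -[leLHS]add0r lerD ?ler0c ?mulr_ge0 ?(ltW K0) //.
apply: ler_sum => i _; rewrite linearZ /= normrM.
by rewrite ler_wpM2r ?bound.
Qed.

End NormBound.

(** * Entries of positive semidefinite forms *)

Section PositiveForms.
Variables (R : realType) (I : finType) (F : I -> I -> R[i]).
Local Notation C := R[i].
Hypothesis F_psd : forall w : I -> C,
  0 <= \sum_a \sum_b Num.conj (w a) * F a b * w b.

(** The form is tested on x e_a + y e_b; the case a = b is allowed. *)
Let psd2 a b x y : 0 <= Num.conj x * F a a * x + Num.conj x * F a b * y +
  (Num.conj y * F b a * x + Num.conj y * F b b * y).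
Proof.
have sel (G : I -> C) c z : \sum_e G e * (z * (e == c)%:R) = G c * z.
  rewrite (bigD1 c) //= big1 => [|e /negPf ->]; last by rewrite !mulr0.
  by rewrite eqxx mulr1 addr0.
pose w e := x * (e == a)%:R + y * (e == b)%:R.
have sel2 (G : I -> C) : \sum_e G e * w e = G a * x + G b * y.
  by under eq_bigr do rewrite mulrDr; rewrite big_split /= !sel.
have := F_psd w; under eq_bigr do rewrite sel2.
have sel2' (G : I -> C) : \sum_e Num.conj (w e) * G e = Num.conj x * G a + Num.conj y * G b.
  under eq_bigr => e _ do rewrite mulrC rmorphD !rmorphM !rmorph_nat mulrDr.
  by rewrite big_split /= !sel (mulrC (G a)) (mulrC (G b)).
under eq_bigr do rewrite -!mulrA -mulrDr.
by rewrite sel2' !mulrDr !mulrA.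
Qed.

Lemma psd_diag_ge0 a : 0 <= F a a.
Proof.
by have := psd2 a a 1 0; rewrite conjC0 conjC1 !mul0r !mulr0 !addr0 mul1r mulr1.
Qed.

(** The form is real at (1, 1) and at (1, 'i), which determines the imaginary and the real part of
    [F b a]. *)
Lemma psd_hermitian a b : F b a = Num.conj (F a b).
Proof.
have /ger0_Im := psd2 a b 1 1; have /ger0_Im := psd2 a b 1 'i%C.
have /ger0_Im := psd_diag_ge0 a; have /ger0_Im := psd_diag_ge0 b.
rewrite conjC1 !mul1r !mulr1.
have -> : Num.conj 'i%C = - 'i%C :> C by apply/eqP; rewrite eq_complex /= oppr0 !eqxx.
case: (F a a) => aa1 aa2; case: (F b b) => bb1 bb2.
case: (F a b) => ab1 ab2; case: (F b a) => ba1 ba2 /= -> -> h1 h2.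
by apply/eqP; rewrite eq_complex /=; apply/andP; split; apply/eqP; lra.
Qed.

Lemma psd_zero_row a b : F a a = 0 -> F a b = 0.
Proof.
move=> aa; apply/eqP/contraT => ab.
pose n := F a b * Num.conj (F a b).
have n0 : 0 < n by rewrite lt_neqAle eq_sym mul_conjC_eq0 ab mul_conjC_ge0.
have bb := psd_diag_ge0 b.
(* At x = - t F a b and y = 1 the form is F b b - 2 t n, which this [t] makes equal to - (F b b + 2)
   < 0. *)
pose t := (F b b + 1) / n.
have tR : Num.conj t = t.
  by apply: conj_Creal; apply: ger0_real; rewrite divr_ge0 ?(ltW n0) // addr_ge0.
have := psd2 a b (- (t * F a b)) 1.
rewrite aa mulr0 mul0r add0r conjC1 !mul1r !mulr1 (psd_hermitian a b).
rewrite rmorphN rmorphM /= tR.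
have -> : - (t * Num.conj (F a b)) * F a b + (Num.conj (F a b) * - (t * F a b) + F b b) =
    F b b - 2 * (t * n) by rewrite /n; ring.
rewrite /t divfK ?gt_eqF // (_ : _ - _ = - (F b b + 2)); last by ring.
rewrite oppr_ge0 => h; have /lt_le_trans/(_ h) : 0 < F b b + 2 by rewrite ltr_wpDl.
by rewrite ltxx.
Qed.

End PositiveForms.

(** * Positivity of the Choi matrix in a rotated basis *)

Section Choi.
Variables (R : realType) (d : nat).
Local Notation C := R[i].
Local Notation M := 'M[C]_d.

Lemma mxblock_form k (B : 'I_k -> 'I_k -> M) (w : 'I_k -> 'cV[C]_d) :
  (\mxcol_i w i)^t* *m \mxblock_(i, j) B i j *m \mxcol_i w i =
  \sum_i \sum_j (w i)^t* *m B i j *m w j.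
Proof.
have -> : (\mxcol_i w i)^t* = \mxrow_i (w i)^t*.
  by apply/matrixP => i j; rewrite !mxE.
rewrite mul_mxrow_mxblock mul_mxrow_mxcol exchange_big; apply: eq_bigr => j _.
by rewrite mulmx_suml.
Qed.

(** Complete positivity is applied to the blocks U^* e_ij U, which form a positive matrix. Testing
    the result on the vectors U^* u_i, with u_i the i-th slice of w, gives the form stated. *)
Lemma choi_psd (tau : 'End(M)) (U : M) : completely_positive tau -> U \is unitarymx ->
  forall w : 'I_d * 'I_d -> C, 0 <= \sum_a \sum_b Num.conj (w a) *
    (Ad U \o tau \o Ad (U^t*))%VF (delta_mx a.1 b.1) a.2 b.2 * w b.
Proof.
move=> tauP hU w.
pose B (i j : 'I_d) : M := Ad (U^t*) (delta_mx i j).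
have psdB : psdmx (\mxblock_(i < d, j < d) B i j).
  move=> v; rewrite -[v]submxcolK mxblock_form; set u := submxcol v.
  (* The block matrix has rank at most one: its form at u is the squared modulus of this linear
     functional. *)
  pose s := \sum_i (U *m u i) i 0.
  rewrite (_ : (_ : 'M_1) 0 0 = Num.conj s * s).
    by rewrite mulrC mul_conjC_ge0.
  rewrite rmorph_sum mulr_suml summxE; apply: eq_bigr => i _.
  rewrite mulr_sumr summxE; apply: eq_bigr => j _.
  rewrite /B AdE trmxCK.
  have -> : (u i)^t* *m (U^t* *m delta_mx i j *m U) *m u j =
      (U *m u i)^t* *m delta_mx i j *m (U *m u j).
    by rewrite trmx_mul map_mxM !mulmxA.
  rewrite mxE (bigD1 j) //= big1 ?addr0 => [|k kj].
    rewrite mxE (bigD1 i) //= big1 ?addr0 => [|k ki].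
      by move: (U *m u i) (U *m u j) => p q; rewrite !mxE !eqxx mulr1.
    by rewrite [delta_mx _ _ _ _]mxE (negPf ki) mulr0.
  rewrite mxE big1 ?mul0r // => l _.
  by rewrite [delta_mx _ _ _ _]mxE (negPf kj) andbF mulr0.
pose u i : 'cV[C]_d := \col_k w (i, k).
have := tauP d B psdB (\mxcol_i (U^t* *m u i)).
rewrite (mxblock_form (fun i j => tau (B i j))) summxE.
pose f (a b : 'I_d * 'I_d) : C := Num.conj (w a) *
  (Ad U \o tau \o Ad (U^t*))%VF (delta_mx a.1 b.1) a.2 b.2 * w b.
have fE : \sum_a \sum_b f a b = \sum_i \sum_k \sum_j \sum_l f (i, k) (j, l).
  rewrite [RHS]pair_bigA; apply: eq_bigr => -[i k] _ /=.
  by rewrite [RHS]pair_bigA; apply: eq_bigr => -[j l].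
rewrite [X in _ -> 0 <= X]fE; congr (0 <= _); apply: eq_bigr => i _; rewrite summxE.
rewrite exchange_big; apply: eq_bigr => j _ /=.
rewrite trmx_mul map_mxM trmxCK.
pose X := U *m tau (B i j) *m U^t*.
have fX k l : f (i, k) (j, l) = Num.conj (w (i, k)) * X k l * w (j, l).
  by rewrite /f /= 2!comp_lfunE AdE.
have -> : (u i)^t* *m U *m tau (B i j) *m (U^t* *m u j) = (u i)^t* *m X *m u j.
  by rewrite /X !mulmxA.
move: X fX => X fX; rewrite mxE exchange_big /=; apply: eq_bigr => l _.
rewrite mxE mulr_suml; apply: eq_bigr => k _.
by rewrite fX !mxE.
Qed.

End Choi.

(** * Diagonalizing the algebra and identifying its conditional expectation *)

Section Diagonalization.
Variables (R : realType) (d : nat) (A : {vspace 'M[R[i]]_d}).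
Local Notation C := R[i].
Local Notation M := 'M[C]_d.
Hypotheses (A_cstar : unital_cstar_subalgebra A) (A_comm : commutative_subspace A).

(* Commuting matrices are triangular in a common orthonormal basis; so are their
   adjoints, as A is closed under them, hence all are diagonal there. *)
Lemma simultaneous_unitary_diagonalization :
  exists2 U : M, U \is unitarymx &
    forall X, X \in A -> forall i j, i != j -> (Ad U X) i j = 0.
Proof.
have comm : {in (vbasis A : seq M) &, forall X Y, comm_mx X Y}.
  by move=> X Y hX hY; apply: A_comm; exact: vbasis_mem.
have [P hP /allP tri] := cotrigonalization comm.
exists P => // .
have trig X : X \in A -> forall i j : 'I_d, (i < j)%N -> (Ad P X) i j = 0.
  move=> XA i j ij; rewrite (coord_vbasis XA) linear_sum summxE big1 // => b _.
  rewrite linearZ mxE /= AdE -conjymx //.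
  have /tri/is_trig_mxP -> // : (vbasis A)`_b \in (vbasis A : seq M).
    by rewrite mem_nth // size_tuple.
  by rewrite mulr0.
move=> X XA i j; rewrite neq_ltn => /orP[ij|ji]; first exact: trig.
have := trig _ (cstar_star A_cstar XA) _ _ ji.
have -> : Ad P (X^t*) = (Ad P X)^t* by rewrite !AdE 2!adjmxM trmxCK mulmxA.
by rewrite !mxE => /eqP; rewrite conjC_eq0 => /eqP.
Qed.

Variables (U : M).
Hypotheses (U_unitary : U \is unitarymx).
Hypothesis U_diag : forall X, X \in A -> forall i j, i != j -> (Ad U X) i j = 0.

(** The row lists the eigenvalues of a basis of [A] at the i-th common eigenvector, so two indices
    share a class exactly when no element of [A] separates them. *)
Definition joint_spectrum (i : 'I_d) : 'rV[C]_(\dim A) :=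
  \row_b (Ad U (vbasis A)`_b) i i.
Local Notation kappa := joint_spectrum.

Lemma Ad_adjK X : Ad (U^t*) (Ad U X) = X.
Proof. by rewrite -comp_lfunE Ad_comp unitary_multVmx // Ad1 lfunE. Qed.

Lemma Ad_Kadj X : Ad U (Ad (U^t*) X) = X.
Proof. by rewrite -comp_lfunE Ad_comp unitary_mulmxtV // Ad1 lfunE. Qed.

Lemma Ad_joint_spectrum X : X \in A ->
  Ad U X = class_mx kappa (fun c => \sum_b coord (vbasis A) b X * c 0 b).
Proof.
move=> XA; apply/matrixP => i j; rewrite class_mxE.
have [<-|ij] := eqVneq i j; last by rewrite U_diag.
rewrite mulr1n {1}(coord_vbasis XA) linear_sum summxE.
by apply: eq_bigr => b _; rewrite linearZ !mxE.
Qed.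

Lemma Ad_mulmx X Y : Ad U (X *m Y) = Ad U X *m Ad U Y.
Proof.
by rewrite !AdE !mulmxA -(mulmxA _ (U^t*) U) unitary_multVmx // mulmx1.
Qed.

Lemma diag_mulmx_entry X Y i : X \in A -> (Ad U (X *m Y)) i i = (Ad U X) i i * (Ad U Y) i i.
Proof.
move=> XA; rewrite Ad_mulmx mxE (bigD1 i) //= big1 ?addr0 // => k ki.
by rewrite U_diag ?mul0r // eq_sym.
Qed.

(* Lagrange interpolation on the joint spectrum. *)
Lemma class_proj_mem i : Ad (U^t*) (class_proj R kappa (kappa i)) \in A.
Proof.
have U1 : Ad U 1%:M = 1%:M by rewrite AdE mulmx1 unitary_mulmxtV.
have sep (s : seq 'I_d) : exists2 X, X \in A & (Ad U X) i i = 1 /\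
    forall j, j \in s -> kappa j != kappa i -> (Ad U X) j j = 0.
  elim: s => [|j s [X XA [X1 X0]]].
    by exists 1%:M; [exact: cstar_unit|rewrite U1 mxE eqxx].
  have [ji|ji] := eqVneq (kappa j) (kappa i).
    by exists X => //; split=> // k; rewrite inE => /predU1P[->|/X0//]; rewrite ji eqxx.
  have [b hb] : exists b, kappa i 0 b != kappa j 0 b.
    apply/existsP/contraT; rewrite negb_exists => /forallP h.
    by case/eqP: ji; apply/rowP => b; move/(_ b): h; rewrite negbK => /eqP.
  pose v := (vbasis A)`_b; have vA : v \in A.
    by apply: vbasis_mem; rewrite mem_nth // size_tuple.
  have vE k : (Ad U v) k k = kappa k 0 b by rewrite mxE.
  (* This interpolation factor has diagonal entry 1 at i and 0 at j. *)
  pose Y := (kappa i 0 b - kappa j 0 b)^-1 *: (v - kappa j 0 b *: 1%:M).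
  have YA : Y \in A by rewrite memvZ // memvB // memvZ // cstar_unit.
  have YE k : (Ad U Y) k k = (kappa i 0 b - kappa j 0 b)^-1 * (kappa k 0 b - kappa j 0 b).
    have gen (Z : M) a : (Z - a *: 1%:M) k k = Z k k - a by rewrite !mxE eqxx mulr1.
    by rewrite /Y linearZ /= linearB linearZ /= U1 [LHS]mxE gen vE.
  exists (X *m Y); first exact: cstar_mul.
  split=> [|k]; first by rewrite diag_mulmx_entry // X1 YE mul1r mulVf ?subr_eq0.
  rewrite inE diag_mulmx_entry // => /predU1P[-> _|ks ki].
    by rewrite YE subrr !mulr0.
  by rewrite X0 // mul0r.
have [X XA [X1 X0]] := sep (enum 'I_d).
suff <- : Ad U X = class_proj R kappa (kappa i) by rewrite Ad_adjK.
apply/matrixP => j k; rewrite class_mxE.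
have [<-|jk] := eqVneq j k; last by rewrite U_diag.
have [ji|ji] := eqVneq (kappa j) (kappa i); last by rewrite X0 ?mem_enum.
by rewrite -X1 (Ad_joint_spectrum XA) !class_mxE ji !eqxx.
Qed.

(** The right-hand side takes its values in [A], by [class_proj_mem], and leaves a remainder
    orthogonal to [A]; these two properties characterize the orthogonal projection. *)
Lemma cond_exp_Block_mean :
  cond_exp A = (Ad (U^t*) \o Block_mean R kappa \o Ad U)%VF.
Proof.
apply/lfunP => X; rewrite 2!comp_lfunE.
set Y := Ad (U^t*) _.
have YA : Y \in A.
  rewrite /Y [Block_mean _ _ _]lfunE /= /block_mean class_mx_sum linear_sum.
  by apply: memv_suml => i _; rewrite linearZ memvZ // class_proj_mem.
have orth Z : Z \in A -> hs_ip Z (X - Y) = 0.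
  move=> ZA; rewrite /hs_ip.
  have tr_Ad (V : M) : \tr V = \tr (Ad U V).
    by rewrite AdE mxtrace_mulC mulmxA unitary_multVmx // mul1mx.
  rewrite tr_Ad Ad_mulmx (Ad_joint_spectrum (cstar_star A_cstar ZA)).
  rewrite (class_mx_sum _) linearB /= /Y Ad_Kadj mulmx_suml linear_sum big1 // => i _.
  rewrite -scalemxAl linearZ /= mulmxBr raddfB /= 2!tr_class_projM.
  rewrite [X in _ - X](eq_bigr (fun=> (\sum_(j | kappa j == kappa i) (Ad U X) j j) /
    #|[pred j | kappa j == kappa i]|%:R)).
    rewrite sumr_const -[X in _ - X]mulr_natr divfK ?class_card_neq0 //.
    by rewrite subrr mulr0.
  by move=> j /eqP ji; rewrite Block_meanE eqxx mulr1n ji.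
set Z := cond_exp A X.
(* The difference of the two candidates lies in [A] and is orthogonal to [A], hence to itself. *)
apply/eqP; rewrite -subr_eq0; apply/eqP/hs_ip_eq0.
have ZYA : Z - Y \in A by rewrite memvB // cond_exp_mem.
have hsB W : hs_ip W (Z - Y) = hs_ip W (X - Y) - hs_ip W (X - Z).
  rewrite (_ : Z - Y = (X - Y) - (X - Z)); last by rewrite opprB [RHS]addrC addrA subrK.
  by rewrite /hs_ip mulmxBr raddfB.
by rewrite hsB orth // cond_exp_orth // subrr.
Qed.

End Diagonalization.

(** * Constraints on a channel that fixes the class projections *)

Section ChannelsOverBlocks.
Variables (R : realType) (d : nat) (T : eqType) (kappa : 'I_d -> T).
Local Notation C := R[i].
Local Notation M := 'M[C]_d.
Local Notation Phi := (Block_mean R kappa).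

Lemma Block_mean_idem : (Phi \o Phi)%VF = Phi.
Proof.
apply/lfunP => X; apply/matrixP => k l; rewrite comp_lfunE Block_meanE [RHS]Block_meanE.
congr (_ *+ _); set s := (X in _ = X).
rewrite (eq_bigr (fun=> s)) => [|j /eqP jk]; last by rewrite Block_meanE eqxx jk.
by rewrite sumr_const -[X in X / _]mulr_natr mulfK // class_card_neq0.
Qed.

Lemma Block_mean_hermitian : hermitian_map Phi.
Proof.
move=> X; apply/matrixP => k l.
have -> : (Phi X)^t* k l = Num.conj (Phi X l k) by rewrite !mxE.
rewrite !Block_meanE; have [<-|kl] := eqVneq k l; last by rewrite !mulr0n conjC0.
rewrite !mulr1n rmorphM fmorphV rmorph_nat rmorph_sum; congr (_ / _).
by apply: eq_bigr => j _; rewrite !mxE.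
Qed.

(** [sigma] stands for the channel in the diagonalizing basis. [sigma_range] is the form taken by
    the range condition: a matrix commuting with all class projections has no entries between
    distinct classes. *)
Variable sigma : 'End(M).
Hypothesis sigma_psd : forall w : 'I_d * 'I_d -> C, 0 <= \sum_a \sum_b
  Num.conj (w a) * sigma (delta_mx a.1 b.1) a.2 b.2 * w b.
Hypothesis sigma_tr : forall X, \tr (sigma X) = \tr X.
Hypothesis sigma_fix : forall i,
  sigma (class_proj R kappa (kappa i)) = class_proj R kappa (kappa i).
Hypothesis sigma_range : forall X k l, kappa k != kappa l -> sigma X k l = 0.

Let choi (a b : 'I_d * 'I_d) : C := sigma (delta_mx a.1 b.1) a.2 b.2.

Lemma lfun_entry (G : 'End(M)) X k l :
  G X k l = \sum_i \sum_j X i j * G (delta_mx i j) k l.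
Proof.
rewrite {1}[X]matrix_sum_delta linear_sum summxE; apply: eq_bigr => i _.
by rewrite linear_sum summxE; apply: eq_bigr => j _; rewrite linearZ mxE.
Qed.

Lemma channel_hermitian : hermitian_map sigma.
Proof.
move=> X; apply/matrixP => l k.
have -> : (sigma X)^t* l k = Num.conj (sigma X k l) by rewrite !mxE.
rewrite [sigma (X^t*) _ _]lfun_entry exchange_big [sigma X _ _]lfun_entry rmorph_sum.
apply: eq_bigr => i _; rewrite rmorph_sum; apply: eq_bigr => j _.
rewrite rmorphM !mxE; congr (_ * _).
exact: (@psd_hermitian _ _ choi sigma_psd (i, k) (j, l)).
Qed.

Lemma class_proj_sum c :
  class_proj R kappa c = \sum_(j | kappa j == c) delta_mx j j.
Proof.
apply/matrixP => k l; rewrite class_mxE summxE.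
have [kc|kc] := eqVneq (kappa k) c.
  rewrite (bigD1 k) ?kc //= big1 ?addr0 => [|j /andP[_ jk]].
    by rewrite !mxE eqxx eq_sym.
  by rewrite mxE eq_sym (negPf jk).
rewrite mul0rn big1 // => j /eqP jc; rewrite mxE.
by case: (k =P j) kc => //= ->; rewrite jc eqxx.
Qed.

(** Entry (k, k) of the fixed class projection of i is zero, and it is a sum of nonnegative Choi
    diagonal entries, one of which is the entry in question. *)
Lemma channel_diag_support i k : kappa k != kappa i -> sigma (delta_mx i i) k k = 0.
Proof.
move=> ki; have := congr1 (fun X : M => X k k) (sigma_fix i).
rewrite /= class_mxE eqxx (negPf ki) class_proj_sum linear_sum summxE => /psumr_eq0P h.
apply: h => // j _; exact: (@psd_diag_ge0 _ _ choi sigma_psd (j, k)).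
Qed.

(** In a positive Choi matrix a zero diagonal entry kills its row and its column, so
    [channel_diag_support] ties k to i and l to j; the range condition ties k to l. *)
Lemma channel_support i j k l : sigma (delta_mx i j) k l != 0 ->
  [/\ kappa k = kappa l, kappa i = kappa l & kappa j = kappa l].
Proof.
move=> s0.
have kl : kappa k = kappa l by apply/eqP; apply: contraNT s0 => /sigma_range ->.
have ki : kappa k = kappa i.
  apply/eqP; apply: contraNT s0 => /channel_diag_support h.
  exact/eqP/(@psd_zero_row _ _ choi sigma_psd (i, k) (j, l)).
have lj : kappa l = kappa j.
  apply/eqP; apply: contraNT s0 => /channel_diag_support h.
  have z : choi (j, l) (i, k) = 0 by apply: psd_zero_row.
  apply/eqP; rewrite -[LHS]/(choi (i, k) (j, l)).
  by rewrite (@psd_hermitian _ _ choi sigma_psd (j, l) (i, k)) z conjC0.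
by split; rewrite // -?ki -?lj.
Qed.

Lemma Block_mean_support i j k l : Phi (delta_mx i j) k l != 0 ->
  [/\ kappa k = kappa l, kappa i = kappa l & kappa j = kappa l].
Proof.
have [<-|ij] := eqVneq i j; last by rewrite Block_mean_delta_neq // mxE eqxx.
rewrite Block_meanE; have [<-|kl] := eqVneq k l; last by rewrite mulr0n eqxx.
have [ik|ik] := eqVneq (kappa i) (kappa k); first by rewrite ik.
rewrite big1 ?mul0r ?mul0rn ?eqxx // => m /eqP mk; rewrite mxE andbb.
by case: (m =P i) ik => //= <-; rewrite mk eqxx.
Qed.

Lemma channel_Block_mean : (sigma \o Phi)%VF = Phi.
Proof.
apply/lfunP => X; rewrite comp_lfunE [Phi X]lfunE /= /block_mean class_mx_sum linear_sum.
by apply: eq_bigr => i _; rewrite linearZ /= sigma_fix.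
Qed.

(** By the support constraint, trace preservation holds class by class, and the block mean depends
    only on the traces over the classes. *)
Lemma Block_mean_channel : (Phi \o sigma)%VF = Phi.
Proof.
have tr_class c (Y : M) : (forall k, kappa k != c -> Y k k = 0) ->
    \sum_(k | kappa k == c) Y k k = \tr Y.
  by move=> h; rewrite big_mkcond; apply: eq_bigr => k _; case: ifPn => // /h ->.
have delta_case c i j : \sum_(k | kappa k == c) sigma (delta_mx i j) k k =
    \sum_(k | kappa k == c) (delta_mx i j : M) k k.
  have [ic|ic] := eqVneq (kappa i) c.
    rewrite (tr_class _ (sigma _)) => [|k kc]; last first.
      apply/eqP; apply: contraNT kc => /channel_support[_ ik _].
      by rewrite -ik ic.
    rewrite sigma_tr tr_class // => k kc.
    by rewrite mxE; case: (k =P i) kc => //= ->; rewrite ic eqxx.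
  rewrite !big1 // => k /eqP kc.
    by rewrite mxE; case: (k =P i) ic => //= <-; rewrite kc eqxx.
  by apply/eqP; apply: contraNT ic => /channel_support[_ -> _]; rewrite kc.
apply/lfunP => X; apply/matrixP => k l; rewrite comp_lfunE !Block_meanE.
congr (_ / _ *+ _).
have expand (G : 'End(M)) : \sum_(m | kappa m == kappa k) G X m m =
    \sum_i \sum_j X i j * \sum_(m | kappa m == kappa k) G (delta_mx i j) m m.
  under eq_bigr do rewrite lfun_entry.
  rewrite exchange_big; apply: eq_bigr => i _; rewrite exchange_big.
  by apply: eq_bigr => j _; rewrite mulr_sumr.
transitivity (\sum_(m | kappa m == kappa k) (\1%VF X : M) m m).
  rewrite (expand sigma) expand; apply: eq_bigr => i _; apply: eq_bigr => j _.
  by rewrite delta_case; under [in RHS]eq_bigr do rewrite id_lfunE.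
by apply: eq_bigr => m _; rewrite id_lfunE.
Qed.

End ChannelsOverBlocks.

(** * Assembly: choice of the radius and return to the original basis *)

Theorem theorem5p10 (R : realType) (d : nat)
    (N : 'End('M[R[i]]_d) -> R) (N_norm : is_norm N)
    (A : {vspace 'M[R[i]]_d})
    (A_cstar : unital_cstar_subalgebra A)
    (A_comm : commutative_subspace A) :
  exists2 eps : R, 0 < eps &
    forall tau : 'End('M[R[i]]_d),
      quantum_channel tau ->
      unital_map tau ->
      [set X | X \in A] `<=`
        [set X | X \in fixedSpace tau] `&` commutant [set X | X \in limg tau] ->
      N (cond_exp A - tau) < eps ->
      mixed_twisted_dephasing tau.
Proof.
have [U hU U_diag] := simultaneous_unitary_diagonalization A_cstar A_comm.
pose kappa := joint_spectrum A U; pose Phi := Block_mean R kappa.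
have AdU G : (Ad (U^t*) \o (Ad U \o G \o Ad (U^t*)) \o Ad U)%VF = G.
  apply/lfunP => X; rewrite !comp_lfunE.
  by rewrite (Ad_adjK hU) (Ad_adjK hU).
have [t t0 near] := mixed_near_Block_mean R kappa.
pose I := (('I_d * 'I_d) * ('I_d * 'I_d))%type.
pose entry (a : I) (G : 'End('M[R[i]]_d)) : R[i]^o :=
  (Ad U \o G \o Ad (U^t*))%VF (delta_mx a.1.1 a.1.2) a.2.1 a.2.2.
have bound a : exists K : R, 0 < K /\ forall G, `|entry a G| <= (K * N G)%:C.
  have entry_lin : linear (entry a).
    move=> x G H; rewrite /entry !comp_lfunE add_lfunE scale_lfunE.
    by rewrite linearD linearZ 2!mxE.
  pose l : {linear 'End('M[R[i]]_d) -> R[i]^o} :=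
    HB.pack (entry a) (GRing.isLinear.Build _ _ _ _ (entry a) entry_lin).
  by have [K K0 hK] := linear_functional_bound l N_norm; exists K.
have [K hK] := choice bound.
(* [S] dominates every [K a], so N (E_A - tau) < t / S bounds all matrix entries of sigma - Phi by
   [t]. *)
pose S := 1 + \sum_a K a.
have S0 : 0 < S by rewrite ltr_pwDl // sumr_ge0 // => a _; rewrite ltW //; case: (hK a).
exists (t / S) => [|tau [tauCP tauTP] _ hA]; first exact: divr_gt0.
rewrite ltr_pdivlMr // => close.
pose sigma := (Ad U \o tau \o Ad (U^t*))%VF.
have sigmaE X : sigma X = Ad U (tau (Ad (U^t*) X)) by rewrite !comp_lfunE.
have sigma_psd := choi_psd tauCP hU.
have tr_Ad (V X : 'M[R[i]]_d) : V \is unitarymx -> \tr (Ad V X) = \tr X.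
  by move=> hV; rewrite AdE mxtrace_mulC mulmxA unitary_multVmx // mul1mx.
have sigma_tr X : \tr (sigma X) = \tr X.
  by rewrite sigmaE (tr_Ad _ _ hU) tauTP; exact: (tr_Ad _ _ (adjmx_unitary hU)).
have PA i := class_proj_mem A_cstar hU U_diag i.
have sigma_fix i : sigma (class_proj R kappa (kappa i)) = class_proj R kappa (kappa i).
  have [/fixedSpaceP h _] := hA _ (PA i).
  by rewrite sigmaE [tau _]h (Ad_Kadj hU).
(* Compare the entries (k, l) of P sigma(X) = sigma(X) P for P the class projection of k: the left
   side keeps the entry, the right side kills it. *)
have sigma_range X k l : kappa k != kappa l -> sigma X k l = 0.
  move=> kl; have [_ /(_ (tau (Ad (U^t*) X)))] := hA _ (PA k).
  rewrite /= memv_img ?memvf // => /(_ isT) /(congr1 (Ad U)).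
  rewrite 2!(Ad_mulmx hU) (Ad_Kadj hU) -sigmaE.
  move=> /(congr1 (fun Y : 'M_d => Y k l)).
  rewrite /= mul_diag_mx mul_mx_diag !mxE eqxx mul1r => ->.
  by rewrite eq_sym (negPf kl) mulr0.
have condE : (Ad U \o cond_exp A \o Ad (U^t*))%VF = Phi.
  rewrite (cond_exp_Block_mean A_cstar hU U_diag); apply/lfunP => X.
  by rewrite !comp_lfunE !(Ad_Kadj hU).
(* It remains to verify the conditions of [mixed_near_Block_mean] for D = sigma - Phi. *)
have -> : tau = (Ad (U^t*) \o (Phi + (sigma - Phi)) \o Ad U)%VF.
  by rewrite addrC subrK /sigma AdU.
apply: (mixed_Ad (adjmx_unitary hU) hU).
have ND0 := is_norm_ge0 N_norm (cond_exp A - tau).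
apply: near.
- have := hermitian_comb 1 (-1) (channel_hermitian sigma_psd)
    (@Block_mean_hermitian R d _ kappa).
  by rewrite scale1r rmorphN1 scaleN1r.
- by rewrite comp_lfunDl comp_lfunNl (channel_Block_mean sigma_fix) Block_mean_idem subrr.
- by rewrite comp_lfunDr comp_lfunNr Block_mean_channel // Block_mean_idem subrr.
- move=> i j k l; have [s0|s0] := eqVneq (sigma (delta_mx i j) k l) 0; last first.
    by move=> _; exact: (channel_support sigma_psd sigma_fix sigma_range).
  rewrite add_lfunE opp_lfunE 2!mxE s0 sub0r oppr_eq0; exact: Block_mean_support.
- move=> i j k l.
  have -> : `|(sigma - Phi) (delta_mx i j) k l| = `|entry ((i, j), (k, l)) (cond_exp A - tau)|.
    rewrite -normrN /entry comp_lfunDr comp_lfunDl comp_lfunNr comp_lfunNl condE -/sigma.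
    by rewrite /= -opprB opp_lfunE [in LHS]mxE opprK.
  have [_ h] := hK ((i, j), (k, l)).
  apply: le_trans (h _) _; rewrite lecR; apply: le_trans (ltW close); rewrite mulrC ler_wpM2l //.
  rewrite /S (bigD1 ((i, j), (k, l))) //= addrCA lerDl addr_ge0 // sumr_ge0 // => a _.
  by rewrite ltW //; case: (hK a).
Qed.
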